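(* The Reedy category $\Delta\circlearrowright\Delta$ (with direct and inverse subcategories $(\Delta\circlearrowright\Delta)^+$ and $(\Delta\circlearrowright\Delta)^-$ and degree function $d[n\circlearrowright k]=n+|\mathrm{Ob}(\mathcal D_{n,k})|$) is elegant.
   Context: **Actions.** For a small category $\mathcal C$, let $C_0,C_1$ be its sets of objects and morphisms, with source and target maps $s,t$. An action of $\mathcal C$ on a set $A$ consists of a moment map $\mu:A\to C_0$ and an action map $\bullet:\{(f,a)\in C_1\times A: s(f)=\mu(a)\}\to A$ such that $\mu(f\bullet a)=t(f)$, $(f\circ f')\bullet a=f\bullet(f'\bullet a)$ whenever defined, and $\mathrm{id}_{\mu(a)}\bullet a=a$. A *rooted action* of $\mathcal C$ on a small category $\mathcal D$, written $\mathcal C\circlearrowright\mathcal D$, is an action of $\mathcal C$ on the set $D_1$ of morphisms of $\mathcal D$ such that $\mu(g\circ g')=\mu(g)$ for all composable $g,g'\in D_1$, and $s(f\bullet g)=s(g)$ whenever $f\bullet g$ is defined. For an object $x$ of $\mathcal D$ put $\mu(x):=\mu(\mathrm{id}_x)$; then $\mu(g)=\mu(t(g))$. $\mathcal{RA}$ is the category of rooted actions; a morphism $X:(\mathcal C\circlearrowright\mathcal D)\to(\mathcal C'\circlearrowright\mathcal D')$ is a pair of functors $X^c:\mathcal C\to\mathcal C'$, $X^d:\mathcal D\to\mathcal D'$ with $\mu(X^d(g))=X^c(\mu(g))$ and $X^d(f\bullet g)=X^c(f)\bullet X^d(g)$. **The objects $[n\circlearrowright k]$** ($n\ge0$, $k\ge-1$).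 Let $[n]$ be the ordered set $0\le1\le\dots\le n$ viewed as a category, $[-1]=\varnothing$. $\mathcal C_{n,k}$ is the disjoint union of $[n]$ and a discrete category with objects $*_0,\dots,*_{k-1}$; write $p_{i,j}:i\to j$ for the unique map in $[n]$. $\mathcal D_{n,-1}$ is empty. For $k\ge0$, $\mathcal D_{n,k}$ is a free category built inductively: $\mathcal D_{0,k}=[k]$ with $\mu(i)=*_i$ for $0\le i<k$ and $\mu(k)=0$; and $\mathcal D_{n,k}$ is obtained from $\mathcal D_{n-1,k}$ by freely adjoining, for each morphism $h$ of $\mathcal D_{n-1,k}$ (identities and composites included) with $\mu(h)=n-1$, a new object $(n,h)$ (distinct for distinct $h$) and a new generating arrow $p_{n-1,n}\bullet h:s(h)\to(n,h)$, with $\mu((n,h))=n$. The action of $\mathcal C_{n,k}$ on $\mathcal D_{n,k}$ is $p_{\ell,\ell'}\bullet h=p_{\ell'-1,\ell'}\bullet(\cdots\bullet(p_{\ell,\ell+1}\bullet h))$, identities acting trivially. This rooted action is $[n\circlearrowright k]$. $\Delta\circlearrowright\Delta$ is the full subcategory of $\mathcal{RA}$ on the objects $[n\circlearrowright k]$, $n\ge0,k\ge-1$. **Notation for maps.** A map $X:[n\circlearrowright k]\to[m\circlearrowright\ell]$ is determined by its restrictions $\alpha=X^c|_{[n]}:[n]\to\mathcal C_{m,\ell}$ and $\beta=X^d|_{\mathcal D_{0,k}}:[k]\to\mathcal D_{m,\ell}$; write $X=(\alpha,\beta)$, $\hat\alpha=X^c$, $\hat\beta=X^d$. **Subcategories.**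 $(\Delta\circlearrowright\Delta)^+$: maps $(\alpha,\beta)$ with $\alpha:[n]\to\mathcal C_{m,\ell}$ and $\beta:[k]\to\mathcal D_{m,\ell}$ injective on objects. $(\Delta\circlearrowright\Delta)^-$: maps $(\alpha,\beta)$ such that every object of $[m]\subseteq\mathcal C_{m,\ell}$ is in the image of $\alpha$ and $\hat\beta:\mathcal D_{n,k}\to\mathcal D_{m,\ell}$ is surjective on objects. **Reedy category.** A small category $\mathcal R$ with wide subcategories (i.e. containing all objects) $\mathcal R^+,\mathcal R^-$ and a function $d:\mathrm{Ob}\,\mathcal R\to\mathbb N$ such that every non-identity morphism of $\mathcal R^+$ raises degree, every non-identity morphism of $\mathcal R^-$ lowers degree, and every morphism of $\mathcal R$ factors uniquely as a morphism of $\mathcal R^-$ followed by a morphism of $\mathcal R^+$. **Elegance.** Let $F:\mathcal R\to\mathrm{Set}^{\mathcal R^{op}}$, $F(r)=\mathrm{Hom}(-,r)$, be the Yoneda functor. A Reedy category $\mathcal R$ is *elegant* if for every pair of maps $\sigma_i:r\to a_i$ ($i=1,2$) in $\mathcal R^-$ there exist $\tau_i:a_i\to b$ in $\mathcal R^-$ with $\tau_1\sigma_1=\tau_2\sigma_2$ such that the square formed by $F\sigma_1,F\sigma_2,F\tau_1,F\tau_2$ is a pushout in $\mathrm{Set}^{\mathcal R^{op}}$. *)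

(* Defs.v *)
From mathcomp Require Import all_boot.
From Stdlib Require Import FunctionalExtensionality ProofIrrelevance.
Set Implicit Arguments.
Unset Strict Implicit.
Unset Printing Implicit Defensive.

(* [cmp g f] is the composite g o f.  It is a total function, but only its
   values at composable pairs (src g = tgt f) are constrained, and nothing
   below depends on the other values. *)
Record cat_on (O M : Type) := CatOn {
  src_ : M -> O;
  tgt_ : M -> O;
  idm_ : O -> M;
  cmp_ : M -> M -> M;
  src_idm_ : forall x, src_ (idm_ x) = x;
  tgt_idm_ : forall x, tgt_ (idm_ x) = x;
  src_cmp_ : forall g f, src_ g = tgt_ f -> src_ (cmp_ g f) = src_ f;
  tgt_cmp_ : forall g f, src_ g = tgt_ f -> tgt_ (cmp_ g f) = tgt_ g;
  cmp_idl_ : forall f, cmp_ (idm_ (tgt_ f)) f = f;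
  cmp_idr_ : forall f, cmp_ f (idm_ (src_ f)) = f;
  cmp_assoc_ : forall h g f, src_ h = tgt_ g -> src_ g = tgt_ f ->
    cmp_ h (cmp_ g f) = cmp_ (cmp_ h g) f }.

Record smallcat := SmallCat {
  obj : Type; mor : Type; cat_struct : cat_on obj mor }.

Record fincat := FinCat {
  fobj : finType; fmor : finType; fcat_struct : cat_on fobj fmor }.

Coercion fincat_smallcat (C : fincat) : smallcat := SmallCat (fcat_struct C).

Section CatTheory.
Variable C : smallcat.
Definition src : mor C -> obj C := src_ (cat_struct C).
Definition tgt : mor C -> obj C := tgt_ (cat_struct C).
Definition idm : obj C -> mor C := idm_ (cat_struct C).
Definition cmp : mor C -> mor C -> mor C := cmp_ (cat_struct C).
Lemma src_idm x : src (idm x) = x. Proof. exact: src_idm_. Qed.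
Lemma tgt_idm x : tgt (idm x) = x. Proof. exact: tgt_idm_. Qed.
Lemma src_cmp g f : src g = tgt f -> src (cmp g f) = src f.
Proof. exact: src_cmp_. Qed.
Lemma tgt_cmp g f : src g = tgt f -> tgt (cmp g f) = tgt g.
Proof. exact: tgt_cmp_. Qed.
Lemma cmp_idl f : cmp (idm (tgt f)) f = f. Proof. exact: cmp_idl_. Qed.
Lemma cmp_idr f : cmp f (idm (src f)) = f. Proof. exact: cmp_idr_. Qed.
Lemma cmp_assoc h g f : src h = tgt g -> src g = tgt f ->
  cmp h (cmp g f) = cmp (cmp h g) f.
Proof. exact: cmp_assoc_. Qed.
End CatTheory.

Record functor (C D : smallcat) := Functor {
  fob : obj C -> obj D;
  fmap : mor C -> mor D;
  src_fmap : forall f, src (fmap f) = fob (src f);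
  tgt_fmap : forall f, tgt (fmap f) = fob (tgt f);
  fmap_idm : forall x, fmap (idm x) = idm (fob x);
  fmap_cmp : forall g f, src g = tgt f -> fmap (cmp g f) = cmp (fmap g) (fmap f) }.

Lemma functor_ext (C D : smallcat) (F G : functor C D) :
  fob F =1 fob G -> fmap F =1 fmap G -> F = G.
Proof.
case: F G => [Fo Fm p1 p2 p3 p4] [Go Gm q1 q2 q3 q4] /= eo em.
have Eo : Fo = Go by exact: functional_extensionality.
have Em : Fm = Gm by exact: functional_extensionality.
by subst; f_equal; exact: proof_irrelevance.
Qed.

Definition functor_id (C : smallcat) : functor C C.
Proof. by exists id id. Defined.

Definition functor_comp (C D E : smallcat) (G : functor D E) (F : functor C D) :
  functor C E.
Proof.
exists (fob G \o fob F) (fmap G \o fmap F) => /= *.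
- by rewrite !src_fmap.
- by rewrite !tgt_fmap.
- by rewrite !fmap_idm.
- by rewrite !fmap_cmp // src_fmap tgt_fmap; congr (fob F).
Defined.

(* As for [cmp], only the values [act f a] with src f = mu a matter. *)
Record action (C : smallcat) (A : Type) := Action {
  mu : A -> obj C;
  act : mor C -> A -> A;
  mu_act : forall f a, src f = mu a -> mu (act f a) = tgt f;
  act_cmp : forall f f' a, src f = tgt f' -> src f' = mu a ->
    act (cmp f f') a = act f (act f' a);
  act_idm : forall a, act (idm (mu a)) a = a }.

Record rooted_action := RootedAction {
  acting : smallcat;
  acted : smallcat;
  raction :> action acting (mor acted);
  mu_cmp : forall g g', src g = tgt g' -> mu raction (cmp g g') = mu raction g;
  src_act : forall f g, src f = mu raction g -> src (act raction f g) = src g }.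

Record ra_mor (X Y : rooted_action) := RAMor {
  ra_c : functor (acting X) (acting Y);
  ra_d : functor (acted X) (acted Y);
  ra_mu : forall g, mu Y (fmap ra_d g) = fob ra_c (mu X g);
  ra_act : forall f g, src f = mu X g ->
    fmap ra_d (act X f g) = act Y (fmap ra_c f) (fmap ra_d g) }.

Lemma ra_mor_ext X Y (f g : ra_mor X Y) :
  ra_c f = ra_c g -> ra_d f = ra_d g -> f = g.
Proof.
case: f g => [fc fd p q] [gc gd p' q'] /= ec ed.
by subst; f_equal; exact: proof_irrelevance.
Qed.

Definition ra_id X : ra_mor X X.
Proof. by exists (functor_id _) (functor_id _). Defined.

Definition ra_comp X Y Z (g : ra_mor Y Z) (f : ra_mor X Y) : ra_mor X Z.
Proof.
exists (functor_comp (ra_c g) (ra_c f)) (functor_comp (ra_d g) (ra_d f)) => /=.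
- by move=> h; rewrite !ra_mu.
- by move=> h k e; rewrite !ra_act // src_fmap ra_mu e.
Defined.

Record category := Category {
  ob :> Type;
  hom : ob -> ob -> Type;
  hid : forall a, hom a a;
  hcomp : forall a b c, hom b c -> hom a b -> hom a c;
  hcomp_idl : forall a b (f : hom a b), hcomp (hid b) f = f;
  hcomp_idr : forall a b (f : hom a b), hcomp f (hid a) = f;
  hcomp_assoc : forall a b c d (h : hom c d) (g : hom b c) (f : hom a b),
    hcomp h (hcomp g f) = hcomp (hcomp h g) f }.

Arguments hid {_} a.

Definition full_subcategory (C : category) (I : Type) (F : I -> C) : category.
Proof.
exists I (fun i j => hom (F i) (F j)) (fun i => hid (F i))
  (fun i j k g f => hcomp g f) => *.
- exact: hcomp_idl.
- exact: hcomp_idr.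
- exact: hcomp_assoc.
Defined.

Definition RA : category.
Proof.
exists rooted_action ra_mor ra_id ra_comp => *;
  by apply: ra_mor_ext; apply: functor_ext.
Defined.

Definition mor_class (R : category) := forall a b : R, hom a b -> Prop.

Definition is_wide_subcategory (R : category) (P : mor_class R) : Prop :=
  (forall a : R, P a a (hid a)) /\
  (forall (a b c : R) (g : hom b c) (f : hom a b),
     P b c g -> P a b f -> P a c (hcomp g f)).

Inductive is_identity (R : category) : forall a b : R, hom a b -> Prop :=
  | IsIdentity (a : R) : is_identity (hid a).

Record is_reedy (R : category) (Rplus Rminus : mor_class R) (d : R -> nat) :
    Prop := IsReedy {
  reedy_plus_wide : is_wide_subcategory Rplus;
  reedy_minus_wide : is_wide_subcategory Rminus;
  reedy_plus_deg : forall (a b : R) (f : hom a b),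
    Rplus a b f -> ~ is_identity f -> d a < d b;
  reedy_minus_deg : forall (a b : R) (f : hom a b),
    Rminus a b f -> ~ is_identity f -> d b < d a;
  reedy_factor : forall (a b : R) (f : hom a b),
    exists! t : {c : R & (hom a c * hom c b)%type},
      [/\ Rminus _ _ (projT2 t).1, Rplus _ _ (projT2 t).2 &
          f = hcomp (projT2 t).2 (projT2 t).1] }.

Record presheaf (R : category) := Presheaf {
  psh :> R -> Type;
  pshr : forall a b : R, hom a b -> psh b -> psh a;
  pshr_id : forall a (x : psh a), pshr (hid a) x = x;
  pshr_comp : forall a b c (g : hom b c) (f : hom a b) x,
    pshr (hcomp g f) x = pshr f (pshr g x) }.

Record nat_trans (R : category) (P Q : presheaf R) := NatTrans {
  nt :> forall a : R, P a -> Q a;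
  nt_natural : forall (a b : R) (f : hom a b) (x : P b),
    nt (pshr f x) = pshr f (nt x) }.

Definition nt_comp (R : category) (P Q S : presheaf R)
  (v : nat_trans Q S) (u : nat_trans P Q) : nat_trans P S.
Proof.
by exists (fun a x => v a (u a x)) => a b f x; rewrite !nt_natural.
Defined.

Definition yoneda (R : category) (r : R) : presheaf R.
Proof.
exists (fun a => hom a r) (fun a b f x => hcomp x f) => *.
- exact: hcomp_idr.
- exact: hcomp_assoc.
Defined.

Definition yoneda_map (R : category) (r s : R) (f : hom r s) :
  nat_trans (yoneda r) (yoneda s).
Proof.
exists (fun a (x : yoneda r a) => (hcomp f x : yoneda s a)) => *.
exact: hcomp_assoc.
Defined.

Definition is_psh_pushout (R : category) (P A1 A2 B : presheaf R)
    (s1 : nat_trans P A1) (s2 : nat_trans P A2)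
    (t1 : nat_trans A1 B) (t2 : nat_trans A2 B) : Prop :=
  nt_comp t1 s1 = nt_comp t2 s2 /\
  forall (Q : presheaf R) (u1 : nat_trans A1 Q) (u2 : nat_trans A2 Q),
    nt_comp u1 s1 = nt_comp u2 s2 ->
    exists! u : nat_trans B Q, nt_comp u t1 = u1 /\ nt_comp u t2 = u2.

Definition is_elegant (R : category) (Rminus : mor_class R) : Prop :=
  forall (r a1 a2 : R) (s1 : hom r a1) (s2 : hom r a2),
    Rminus r a1 s1 -> Rminus r a2 s2 ->
    exists (b : R) (t1 : hom a1 b) (t2 : hom a2 b),
      [/\ Rminus a1 b t1, Rminus a2 b t2, hcomp t1 s1 = hcomp t2 s2 &
          is_psh_pushout (yoneda_map s1) (yoneda_map s2)
                         (yoneda_map t1) (yoneda_map t2)].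

(* The ordered set 0 <= 1 <= ... <= N-1; thus [n] is [ordcat n.+1], and
   [ordcat 0] is the empty category [-1]. *)
Section OrdCat.
Variable N : nat.
Definition ord_mor := {p : 'I_N * 'I_N | p.1 <= p.2}.
Definition ord_idm (i : 'I_N) : ord_mor := exist _ (i, i) (leqnn i).
Definition ord_cmp (g f : ord_mor) : ord_mor :=
  insubd f ((val f).1, (val g).2).
Lemma val_ord_cmp g f : (val g).1 = (val f).2 ->
  val (ord_cmp g f) = ((val f).1, (val g).2).
Proof.
move=> e; rewrite /ord_cmp val_insubd /= (leq_trans (valP f)) //.
by rewrite -e; exact: (valP g).
Qed.
Definition ordcat_on : cat_on 'I_N ord_mor.
Proof.
exists (fun f => (val f).1) (fun f => (val f).2) ord_idm ord_cmp => //.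
- by move=> g f e; rewrite val_ord_cmp.
- by move=> g f e; rewrite val_ord_cmp.
- by move=> f; apply: val_inj; rewrite val_ord_cmp //=; case: (val f).
- by move=> f; apply: val_inj; rewrite val_ord_cmp //=; case: (val f).
- by move=> h g f e1 e2; apply: val_inj; rewrite !val_ord_cmp //= ?val_ord_cmp.
Defined.
Definition ordcat : fincat := FinCat ordcat_on.
End OrdCat.

Definition disccat_on (T : Type) : cat_on T T.
Proof. by exists id id id (fun _ f => f) => // h g f ->. Defined.
Definition disccat (T : finType) : fincat := FinCat (disccat_on T).

Section SumCat.
Variables C D : fincat.
Let M := (fmor C + fmor D)%type.
Definition sum_cmp (g f : M) : M :=
  match g, f with
  | inl g, inl f => inl (@cmp C g f)
  | inr g, inr f => inr (@cmp D g f)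
  | _, _ => f
  end.
Definition sumcat_on : cat_on (fobj C + fobj D)%type M.
Proof.
exists (fun f : M => match f with inl f => inl (@src C f) | inr f => inr (@src D f) end)
       (fun f : M => match f with inl f => inl (@tgt C f) | inr f => inr (@tgt D f) end)
       (fun x => match x with inl x => inl (@idm C x) | inr x => inr (@idm D x) end)
       sum_cmp.
- by case=> x; rewrite (@src_idm C, @src_idm D).
- by case=> x; rewrite (@tgt_idm C, @tgt_idm D).
- by case=> g [] f //= -[e]; rewrite (@src_cmp C, @src_cmp D).
- by case=> g [] f //= -[e]; rewrite (@tgt_cmp C, @tgt_cmp D).
- by case=> f /=; rewrite (@cmp_idl C, @cmp_idl D).
- by case=> f /=; rewrite (@cmp_idr C, @cmp_idr D).
- by case=> h [] g [] f //= -[e1] [e2]; rewrite (@cmp_assoc C, @cmp_assoc D).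
Defined.
Definition sumcat : fincat := FinCat sumcat_on.

Definition sum_inl : functor C sumcat.
Proof. by exists (fun x => inl x) (fun f => inl f). Defined.
End SumCat.

(* A generating arrow gen h : b h -> new h has a new object as target, and no
   other generator starts there.  Hence the morphisms of the resulting
   category are: those of D; the composites gen h o g for g : x -> b h in D,
   encoded as the pair (h, g); and the identities of the new objects.
   [adjoin_free] below is the universal property. *)
Section Adjoin.
Variables (D : fincat) (H : finType) (b : H -> fobj D).

Definition adj_obj := (fobj D + H)%type.
Definition adj_comp := {p : H * fmor D | @tgt D p.2 == b p.1}.
Definition adj_mor := (fmor D + (adj_comp + H))%type.

Definition adj_src (f : adj_mor) : adj_obj :=
  match f with
  | inl g => inl (@src D g)
  | inr (inl p) => inl (@src D (val p).2)
  | inr (inr h) => inr h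
  end.

Definition adj_tgt (f : adj_mor) : adj_obj :=
  match f with
  | inl g => inl (@tgt D g)
  | inr (inl p) => inr (val p).1
  | inr (inr h) => inr h
  end.

Definition adj_idm (x : adj_obj) : adj_mor :=
  match x with inl x => inl (@idm D x) | inr h => inr (inr h) end.

Definition adj_cmp (g f : adj_mor) : adj_mor :=
  match f, g with
  | inl f, inl g => inl (@cmp D g f)
  | inl f, inr (inl p) =>
      inr (inl (insubd p ((val p).1, @cmp D (val p).2 f)))
  | inl _, inr (inr _) => g (* not composable *)
  | inr (inl _), _ => f     (* g is an identity *)
  | inr (inr _), _ => g     (* f is an identity *)
  end.

Lemma val_adj_cmp (p : adj_comp) f : @src D (val p).2 = @tgt D f ->
  val (insubd p ((val p).1, @cmp D (val p).2 f)) = ((val p).1, @cmp D (val p).2 f).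
Proof.
by move=> e; rewrite val_insubd /= (@tgt_cmp D) // (eqP (valP p)) eqxx.
Qed.

Definition adjoin_on : cat_on adj_obj adj_mor.
Proof.
exists adj_src adj_tgt adj_idm adj_cmp.
- by case=> x //=; rewrite (@src_idm D).
- by case=> x //=; rewrite (@tgt_idm D).
- case=> [g|[p|h]] [f|[q|h']] //=.
  + by case=> e; rewrite (@src_cmp D).
  + by case=> e; rewrite val_adj_cmp //= (@src_cmp D).
- case=> [g|[p|h]] [f|[q|h']] //=.
  + by case=> e; rewrite (@tgt_cmp D).
  + by case=> e; rewrite val_adj_cmp.
- by case=> [f|[p|h]] //=; rewrite (@cmp_idl D).
- case=> [f|[p|h]] //=; first by rewrite (@cmp_idr D).
  congr (inr (inl _)); apply: val_inj.
  by rewrite val_adj_cmp ?(@tgt_idm D) // (@cmp_idr D); case: (val p).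
- case=> [h|[h|h]] [g|[g|g]] [f|[f|f]] //= [e1] [e2].
  + by rewrite (@cmp_assoc D).
  + congr (inr (inl _)); apply: val_inj.
    rewrite val_adj_cmp ?(@tgt_cmp D) // val_adj_cmp val_adj_cmp //=.
      by rewrite (@cmp_assoc D).
    by rewrite (@src_cmp D).
Defined.
Definition adjoin : fincat := FinCat adjoin_on.

Definition adjoin_incl : functor D adjoin.
Proof. by exists (fun x => inl x) (fun f => inl f). Defined.

Definition gen_subproof (h : H) : @tgt D (@idm D (b h)) == b h.
Proof. by rewrite (@tgt_idm D). Qed.
Definition gen (h : H) : mor adjoin :=
  inr (inl (exist _ (h, @idm D (b h)) (gen_subproof h))).

Lemma src_gen h : src (gen h) = inl (b h).
Proof. by rewrite /src /= (@src_idm D). Qed.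
Lemma tgt_gen h : tgt (gen h) = inr h.
Proof. by []. Qed.

Theorem adjoin_free (E : smallcat) (F : functor D E) (e : H -> mor E) :
  (forall h, src (e h) = fob F (b h)) ->
  exists! G : functor adjoin E,
    functor_comp G adjoin_incl = F /\ forall h, fmap G (gen h) = e h.
Proof.
move=> he.
pose Go (x : obj adjoin) : obj E :=
  match x with inl x => fob F x | inr h => tgt (e h) end.
pose Gm (f : mor adjoin) : mor E :=
  match f with
  | inl f => fmap F f
  | inr (inl p) => cmp (e (val p).1) (fmap F (val p).2)
  | inr (inr h) => idm (tgt (e h))
  end.
have hp (p : adj_comp) : src (e (val p).1) = tgt (fmap F (val p).2).
  by rewrite he tgt_fmap (eqP (valP p)).
have G1 f : src (Gm f) = Go (src f).
  case: f => [f|[p|h]] /=; first exact: src_fmap.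
    by rewrite src_cmp ?(src_fmap F) //; exact: hp.
  by rewrite src_idm.
have G2 f : tgt (Gm f) = Go (tgt f).
  case: f => [f|[p|h]] /=; first exact: tgt_fmap.
    by rewrite tgt_cmp //; exact: hp.
  by rewrite tgt_idm.
have G3 x : Gm (idm x) = idm (Go x).
  by case: x => [x|h] //=; rewrite -fmap_idm.
have G4 g f : src g = tgt f -> Gm (cmp g f) = cmp (Gm g) (Gm f).
  case: g f => [g|[p|h]] [f|[q|h']] //= [] E0.
  - exact: fmap_cmp.
  - rewrite /Gm [cmp _ _]/= val_adj_cmp //= fmap_cmp // cmp_assoc //.
      exact: hp.
    by rewrite (src_fmap F) (tgt_fmap F); congr (fob F).
  - by rewrite /Gm /= E0 -(tgt_cmp (hp q)) cmp_idl.
  - by have := cmp_idl (idm (tgt (e h'))); rewrite /Gm /= E0 tgt_idm => ->.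
exists (Functor G1 G2 G3 G4); split.
  split; first exact: functor_ext.
  move=> h; rewrite /= fmap_idm -[RHS]cmp_idr; by rewrite he.
move=> G [GF Ge].
have eo x : fob G (inl x) = fob F x by rewrite -GF.
have em f : fmap G (inl f) = fmap F f by rewrite -GF.
have en h : fob G (inr h) = tgt (e h) by rewrite -Ge tgt_fmap.
apply: functor_ext.
- by case=> [x|h] /=; rewrite ?eo ?en.
- case=> [f|[[[h g] hg]|h]] /=; first by rewrite em.
  + have E0 : @tgt D g = b h := eqP hg.
    rewrite -Ge -em -fmap_cmp; last by rewrite src_gen -E0.
    congr (fmap G (inr (inl _))); apply: val_inj.
    rewrite (@val_adj_cmp (exist _ _ _)) /= -E0; last exact: (@src_idm D).
    by rewrite (@cmp_idl D).
  + by rewrite -en -fmap_idm.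
Qed.
End Adjoin.

(* k >= -1 is represented by K = k + 1 throughout.  The stars are indexed by
   'I_K.-1, which has k elements for k >= 0 and none for k = -1. *)
Definition Ccat (n K : nat) : fincat := sumcat (ordcat n.+1) (disccat 'I_K.-1).

Record moment_cat (n K : nat) := MomentCat {
  mc_cat :> fincat;
  mc_mu : fobj mc_cat -> fobj (Ccat n K) }.

Definition mc_mumor n K (D : moment_cat n K) (g : fmor D) : fobj (Ccat n K) :=
  mc_mu (@tgt D g).

(* mu(i) = *_i for i < k, and mu(k) = 0 *)
Definition base_mu (K : nat) (i : 'I_K) : fobj (Ccat 0 K) :=
  if insub (i : nat) is Some j then inr j else inl ord0.

Definition Cwiden n K (c : fobj (Ccat n K)) : fobj (Ccat n.+1 K) :=
  match c with inl i => inl (widen_ord (leqnSn _) i) | inr j => inr j end.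

Section Grow.
Variables (n K : nat) (D : moment_cat n K).
Definition top_mor := {h : fmor D | mc_mumor h == inl ord_max}.
Definition top_src (h : top_mor) : fobj D := @src D (val h).
Definition grow : moment_cat n.+1 K :=
  @MomentCat n.+1 K (adjoin top_src)
    (fun x => match x with inl x => Cwiden (mc_mu x) | inr _ => inl ord_max end).
End Grow.

Fixpoint Dcat (n K : nat) : moment_cat n K :=
  match n with
  | 0 => @MomentCat 0 K (ordcat K) (@base_mu K)
  | n.+1 => grow (Dcat n K)
  end.

(* [step h] is p_{l,l+1} . h when mu(h) = l < n (irrelevant otherwise) *)
Fixpoint step (n K : nat) : fmor (Dcat n K) -> fmor (Dcat n K) :=
  match n with
  | 0 => fun h => h
  | n.+1 => fun g =>
      match g with
      | inl h => if insub h is Some h' then gen (@top_src n K (Dcat n K)) h'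
                 else inl (step h)
      | inr _ => g
      end
  end.

Definition Dact (n K : nat) (f : fmor (Ccat n K)) (h : fmor (Dcat n K)) :
    fmor (Dcat n K) :=
  match f with
  | inl p => iter ((val p).2 - (val p).1) (@step n K) h
  | inr _ => h
  end.

Section Bracket.
Variables n K : nat.
Notation D := (Dcat n K).

Lemma step_spec m (h : fmor (Dcat m K)) (l : 'I_m.+1) :
  mc_mumor h = inl l -> l < m ->
  @src (Dcat m K) (step h) = @src (Dcat m K) h /\
  exists2 l' : 'I_m.+1, mc_mumor (step h) = inl l' & l' = l.+1 :> nat.
Proof.
elim: m h l => [|m IH] h l; first by rewrite ltn0.
case: h => [h|[p|q]] hm lm.
- have {hm} : Cwiden (mc_mumor h) = inl l by [].
  case E: (mc_mumor h) => [i|//] /= [li].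
  have il : i = l :> nat by rewrite -li.
  case: insubP => [h' hh' vh'|].
    split; first by rewrite src_gen /= /top_src vh'.
    exists ord_max => //=.
    by move/eqP: hh'; rewrite E -il => -[->].
  rewrite E => ne.
  have im : i < m.
    rewrite ltn_neqAle -ltnS ltn_ord andbT.
    by apply: contra ne => /eqP im; apply/eqP; congr inl; apply: val_inj.
  have [s1 [l' e1 e2]] := IH h i E im.
  split; first by rewrite /src /= -/(@src (Dcat m K) _) s1.
  exists (widen_ord (leqnSn _) l'); last by rewrite /= e2 il.
  by rewrite /mc_mumor /= -/(mc_mumor _) e1.
- by case: hm lm => <- /=; rewrite ltnn.
- by case: hm lm => <- /=; rewrite ltnn.
Qed.

Lemma iter_step_spec (h : fmor D) (i j : 'I_n.+1) :
  mc_mumor h = inl i -> i <= j ->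
  @src D (iter (j - i) (@step n K) h) = @src D h /\
  mc_mumor (iter (j - i) (@step n K) h) = inl j.
Proof.
move=> hi ij.
suff H m : i + m <= n ->
    @src D (iter m (@step n K) h) = @src D h /\
    exists2 l : 'I_n.+1, mc_mumor (iter m (@step n K) h) = inl l & l = i + m :> nat.
  have [|s [l e1 e2]] := H (j - i); first by rewrite subnKC // -ltnS.
  by split=> //; rewrite e1; congr inl; apply: val_inj; rewrite /= e2 subnKC.
elim: m => [|m IH] le; first by split=> //; exists i; rewrite ?addn0.
rewrite addnS in le *; have [s [l e1 e2]] := IH (ltnW le).
have [|s' [l' e1' e2']] := step_spec e1; first by rewrite e2.
by split; [rewrite /= s' s | exists l' => //=; rewrite e2' e2].
Qed.

Definition bracket_action : action (Ccat n K) (mor D).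
Proof.
exists (@mc_mumor n K D) (@Dact n K).
- case=> [p|j] a /= e; last by rewrite -e.
  by have [_ ->] := iter_step_spec (esym e) (valP p).
- case=> [p|j] [q|j'] a //= [e1] e2.
  have E1 : (val p).1 = (val q).2 by [].
  rewrite -iterD; congr iter; rewrite val_ord_cmp //= E1.
  by rewrite addnBA ?(valP q) // subnK // -E1 (valP p).
- move=> a; case: (mc_mumor a) => //= i; by rewrite subnn.
Defined.

Definition bracket : rooted_action.
Proof.
exists (Ccat n K) D bracket_action.
- by move=> g g' e; rewrite /= /mc_mumor (@tgt_cmp D).
- move=> [p|j] g //= e.
  by have [-> _] := iter_step_spec (esym e) (valP p).
Defined.
End Bracket.

Record dd_index := DDIndex { dd_n : nat; dd_K : nat }.

Definition DeltaDelta : category :=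
  @full_subcategory RA dd_index (fun i => bracket (dd_n i) (dd_K i)).

Fixpoint Dbase (n K : nat) : functor (ordcat K) (Dcat n K) :=
  match n with
  | 0 => functor_id (ordcat K)
  | n.+1 => functor_comp (adjoin_incl (@top_src n K (Dcat n K))) (Dbase n K)
  end.

Section Maps.
Variables (a b : DeltaDelta) (X : hom a b).

Definition alpha : functor (ordcat (dd_n a).+1) (Ccat (dd_n b) (dd_K b)) :=
  functor_comp (ra_c X) (sum_inl (ordcat (dd_n a).+1) (disccat 'I_(dd_K a).-1)).

Definition beta : functor (ordcat (dd_K a)) (Dcat (dd_n b) (dd_K b)) :=
  functor_comp (ra_d X) (Dbase (dd_n a) (dd_K a)).
End Maps.

Definition DDplus : mor_class DeltaDelta := fun a b X =>
  injective (fob (alpha X)) /\ injective (fob (beta X)).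

Definition DDminus : mor_class DeltaDelta := fun a b X =>
  (forall j : 'I_(dd_n b).+1, exists i, fob (alpha X) i = inl j) /\
  (forall y : obj (acted (bracket (dd_n b) (dd_K b))),
     exists x, fob (ra_d X) x = y).

Definition DDdeg (a : DeltaDelta) : nat :=
  dd_n a + #|fobj (Dcat (dd_n a) (dd_K a))|.

(* Main.v *)
From mathcomp Require Import all_boot zify.
From Stdlib Require Import FunctionalExtensionality ProofIrrelevance.
Require Import Defs.
Set Implicit Arguments.
Unset Strict Implicit.
Unset Printing Implicit Defensive.

(** Each D_{n,k} is the free category on a tree, hence posetal, so functors
    into it are determined on objects.  By freeness a map out of [n o k] into
    any rooted action is the same thing as a functor alpha on [n] and a functor
    beta on [k] with mu(beta(k)) = alpha(0) ([ra_mor_exists], [ra_mor_eq]).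

    The objects of D_{n,k} whose moment is 0 or a star are exactly those of the
    base chain [k].  Hence a map of the inverse subcategory sends the base
    chain onto the base chain: it is nothing but a pair of monotone surjections
    [n] -> [m], [k] -> [l] ([minus_simplicial]).  Such a pair has a section,
    consisting of smallest preimages on [n] and of largest preimages on [k];
    these choices respect the condition mu(beta(k)) = alpha(0), because 0 is
    smallest in [n] and the vertex k of moment 0 is largest in [k]
    ([minus_section]).

    A map of the direct subcategory is injective on all objects of D_{n,k}
    ([plus_inj]), because acting by a non-identity arrow is injective and raises
    the level.  So both subcategories are closed under composition and change
    the degree in the required direction, a map in both being an identity
    ([plus_minus_identity]).  A factorization of (alpha, beta) is obtained from
    the images of alpha and beta ([factor_exists]).  Given two factorizations
    m e = m' e' and a section s of e, the comparison w = e' s satisfies w e = e'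
    and m' w = m, which puts it in both subcategories; so w is an identity.

    For elegance, let s1, s2 be a span in the inverse subcategory, with the
    sections d1, d2 above, and put e_i = d_i s_i.  These endomorphisms are
    monotone idempotents, decreasing on [n] and increasing on [k], so a high
    power e of e1 e2 satisfies e e1 = e = e e2 ([interior_iter]).  Factor
    e = d t with t inverse and d direct; cancelling d gives t e1 = t = t e2, so
    the maps t_i = t d_i complete the span to a commutative square.  If
    x_i are elements of a presheaf with s1^* x1 = s2^* x2 = w, then w is
    invariant under e1 and e2, hence under e, so that w = t^* (d^* w), and d^* w
    is the required common extension ([split_pushout]). *)

(** * Monotone maps between finite ordinals *)

Definition ord_mono (N M : nat) (f : 'I_N -> 'I_M) : Prop :=
  {homo f : x y / (x <= y)%N}.

Definition surj (A B : Type) (f : A -> B) : Prop := forall y, exists x, f x = y.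

Lemma surj_comp A B C (g : B -> C) (f : A -> B) : surj g -> surj f -> surj (g \o f).
Proof. by move=> sg sf z; have [y <-] := sg z; have [x <-] := sf y; exists x. Qed.

Lemma card_surj (A B : finType) (f : A -> B) : surj f -> #|B| <= #|A|.
Proof.
move=> sf; have [g gK] := fin_all_exists sf.
by apply: (@leq_card _ _ g); exact: can_inj gK.
Qed.

Lemma card_surj_inj (A B : finType) (f : A -> B) :
  surj f -> #|A| <= #|B| -> injective f.
Proof.
move=> sf le; have [g gK] := fin_all_exists sf.
have [h Kh hK] := inj_card_bij (can_inj gK : injective g) le.
by move=> x y; rewrite -[x]hK -[y]hK !gK => ->.
Qed.

Lemma card_inj_surj (A B : finType) (f : A -> B) :
  injective f -> #|B| <= #|A| -> surj f.
Proof. by move=> fi le y; have [h Kh hK] := inj_card_bij fi le; exists (h y). Qed.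

Lemma min_section (N P : nat) (s : 'I_N -> 'I_P) : ord_mono s -> surj s ->
  exists g : 'I_P -> 'I_N,
    [/\ ord_mono g, cancel g s & forall x : 'I_N, (g (s x) <= x)%N].
Proof.
move=> sm ss.
have minP j : exists x, s x = j /\ forall y, s y = j -> (x <= y)%N.
  have [x0 /eqP sx0] := ss j.
  case: (@arg_minnP _ x0 (fun x => s x == j) val sx0) => x /eqP sx xm.
  by exists x; split=> // y /eqP /xm.
have [g gP] := fin_all_exists minP; exists g; split.
- move=> j j' jj'; rewrite leqNgt; apply/negP => lt.
  have := sm _ _ (ltnW lt); rewrite (gP j).1 (gP j').1 => jj.
  have E : j = j' by apply: val_inj; apply/eqP; rewrite eqn_leq jj' jj.
  by rewrite E ltnn in lt.
- by move=> j; exact: (gP j).1.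
- by move=> x; apply: (gP _).2.
Qed.

Lemma max_section (N P : nat) (s : 'I_N -> 'I_P) : ord_mono s -> surj s ->
  exists g : 'I_P -> 'I_N,
    [/\ ord_mono g, cancel g s & forall x : 'I_N, (x <= g (s x))%N].
Proof.
move=> sm ss; pose s' x := rev_ord (s (rev_ord x)).
have rm M : {homo @rev_ord M : x y / (x <= y)%N >-> (y <= x)%N}.
  by move=> x y xy /=; lia.
have [||g [gm gK gle]] := @min_section N P s'.
- by move=> x y xy; apply/rm/sm/rm.
- move=> y; have [x sx] := ss (rev_ord y); exists (rev_ord x).
  by rewrite /s' rev_ordK sx rev_ordK.
exists (fun x => rev_ord (g (rev_ord x))); split.
- by move=> x y xy; apply/rm/gm/rm.
- by move=> x; rewrite -[LHS]rev_ordK -/(s' _) gK rev_ordK.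
- move=> x; have := rm _ _ _ (gle (rev_ord x)).
  by rewrite /s' !rev_ordK.
Qed.

Lemma last_ord N (i : 'I_N) : exists z : 'I_N, z.+1 = N /\ (i <= z)%N.
Proof.
case: N i => [|N] i; first by case: i.
by exists ord_max; split=> //; rewrite -ltnS.
Qed.

Lemma ord_mono_surj_zero N P (s : 'I_N.+1 -> 'I_P.+1) :
  ord_mono s -> surj s -> s ord0 = ord0.
Proof.
move=> sm ss; have [x sx] := ss ord0; apply: val_inj => /=.
by have := sm ord0 x (leq0n _); rewrite sx /= leqn0 => /eqP.
Qed.

Lemma ord_mono_surj_last N P (s : 'I_N -> 'I_P) (i : 'I_N) :
  ord_mono s -> surj s -> i.+1 = N -> (s i).+1 = P.
Proof.
move=> sm ss iN; have [z [zP _]] := last_ord (s i).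
have [x sx] := ss z; have xi : x <= i by have := ltn_ord x; lia.
by have := sm _ _ xi; rewrite sx; have := ltn_ord (s i); lia.
Qed.

Lemma min_section_zero N P (s : 'I_N.+1 -> 'I_P.+1) (g : 'I_P.+1 -> 'I_N.+1) :
  ord_mono s -> surj s -> (forall x : 'I__, (g (s x) <= x)%N) -> g ord0 = ord0.
Proof.
move=> sm ss gle; apply: val_inj => /=; apply/eqP; rewrite -leqn0.
by have := gle ord0; rewrite ord_mono_surj_zero.
Qed.

Lemma max_section_last N P (s : 'I_N -> 'I_P) (g : 'I_P -> 'I_N) (i : 'I_P) :
  ord_mono s -> surj s -> (forall x : 'I__, (x <= g (s x))%N) ->
  i.+1 = P -> (g i).+1 = N.
Proof.
move=> sm ss gle iP; have [x _] := ss i; have [z [zN _]] := last_ord x.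
have -> : i = s z.
  by apply: val_inj; apply: succn_inj; rewrite iP (ord_mono_surj_last sm ss zN).
by have := gle z; have := ltn_ord (g (s z)); lia.
Qed.

Lemma ord_mono_inj_id N (f : 'I_N -> 'I_N) : ord_mono f -> injective f -> f =1 id.
Proof.
move=> fm fi.
have lt (x y : 'I_N) : (x < y)%N -> (f x < f y)%N.
  move=> xy; rewrite ltn_neqAle fm ?(ltnW xy) // andbT.
  by apply: contraTneq xy => /val_inj/fi ->; rewrite ltnn.
have up m (x : 'I_N) : x = m :> nat -> (m <= f x)%N.
  elim: m x => // m IH x xm; have mN : m < N by rewrite ltnW // -xm.
  by apply: leq_ltn_trans (IH (Ordinal mN) erefl) _; apply: lt; rewrite /= xm.
have dn m (x : 'I_N) : N - x.+1 = m -> (f x <= x)%N.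
  elim: m x => [|m IH] x xm; first by have := ltn_ord (f x); lia.
  have xN : x.+1 < N by have := ltn_ord x; lia.
  have := IH (Ordinal xN); have := lt x (Ordinal xN) => /= /(_ (leqnn _)) A B.
  by have /= := B ltac:(lia); lia.
by move=> x; apply: val_inj; apply/eqP; rewrite eqn_leq (dn _ x erefl) up.
Qed.

(** The fibres of f are intervals, so f is a sequence without returns: sending x to
    the number of places before x at which f changes its value is the quotient
    of the chain by the fibres. *)
Lemma image_factor (T : eqType) N (f : 'I_N -> T) :
  (forall x y z : 'I_N, (x <= y <= z)%N -> f x = f z -> f x = f y) ->
  exists P (s : 'I_N -> 'I_P),
    [/\ ord_mono s, surj s & forall x y, s x = s y <-> f x = f y].
Proof.
case: N f => [|N] f cvx.
  by exists 0, id; split=> //; [move=> y; exists y | case].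
(* f' extends f to all of nat, so that the jumps can be counted by a sum. *)
pose f' i := f (inord i).
have f'E (x : 'I_N.+1) : f x = f' x by rewrite /f' inord_val.
pose c x := \sum_(i < x) (f' i != f' i.+1).
have cS x : c x.+1 = c x + (f' x != f' x.+1) by rewrite /c big_ord_recr.
have cm x m : c x <= c (x + m).
  elim: m => [|m IH]; first by rewrite addn0.
  by rewrite addnS cS (leq_trans IH) ?leq_addr.
have cm' x y : x <= y -> c x <= c y by move=> xy; rewrite -(subnKC xy).
have c_f x m : c x = c (x + m) -> f' x = f' (x + m).
  elim: m => [|m IH]; first by rewrite addn0.
  rewrite addnS cS => E; have := cm x m.
  case: eqP E => [<- E _|_ /= E le]; last by lia.
  by apply: IH; rewrite E addn0.
have f_c x m : x + m < N.+1 -> f' x = f' (x + m) -> c x = c (x + m).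
  move=> lt E; have flat j : j <= m -> f' (x + j) = f' x.
    move=> jm; rewrite /f'; apply/esym/(@cvx _ _ (inord (x + m))) => //.
    by rewrite !inordK; lia.
  suff H j : j <= m -> c (x + j) = c x by rewrite H.
  elim: j => [|j IH] jm; first by rewrite addn0.
  rewrite addnS cS IH ?(ltnW jm) // -addnS (flat _ jm) (flat _ (ltnW jm)).
  by rewrite eqxx addn0.
have cN (x : 'I_N.+1) : c x < (c N).+1 by rewrite ltnS cm' // -ltnS.
exists (c N).+1, (fun x => Ordinal (cN x)); split.
- by move=> x y xy; apply: cm'.
- move=> y; have hy : y <= c N by rewrite -ltnS.
  have : exists n, (n <= N) && (y <= c n) by exists N; rewrite leqnn.
  case/ex_minnP => n /andP[nN yn] nmin.
  exists (Ordinal (nN : n < N.+1)); apply: val_inj => /=.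
  apply/eqP; rewrite eqn_leq yn andbT; case: n nN yn nmin => [|n] nN yn nmin.
    by rewrite /c big_ord0.
  have : c n < y.
    by rewrite ltnNge; apply/negP => h; have := nmin n; rewrite h andbT; lia.
  by rewrite cS; case: (_ != _) => /=; lia.
- suff H (x y : 'I_N.+1) : (x <= y)%N -> c x = c y <-> f x = f y.
    move=> x y; case: (leqP x y) => [xy|/ltnW yx].
      by rewrite -(H _ _ xy); split=> [[]|E] //; apply: val_inj.
    have := H _ _ yx; split=> [[]|] E; first by apply/esym/H.
    by apply: val_inj; apply/esym/H.
  move=> xy; rewrite !f'E -(subnKC xy); split; first exact: c_f.
  by apply: f_c; rewrite subnKC.
Qed.

Lemma iter_stable (T : Type) (rk : T -> nat) (f : T -> T) :
  (forall x, f x = x \/ rk (f x) < rk x) ->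
  forall n x, rk x <= n -> f (iter n f x) = iter n f x.
Proof.
move=> dec n x; have fixd m y : f y = y -> iter m f y = y.
  by move=> fy; elim: m => //= m ->.
elim: n x => [|n IH] x le.
  by case: (dec x) => //; lia.
case: (dec x) => [fx|lt]; first by rewrite fixd // fx.
by rewrite iterSr IH //; lia.
Qed.

(** For two monotone maps f1, f2 below the identity on an order with bounded
    chains, iterating f1 f2 stabilizes at an idempotent g whose values are fixed
    by both.  Then g absorbs f1, since g (f1 x) <= g x by monotonicity, while
    g x = f1 (g x) <= f1 x and hence g x = g (g x) <= g (f1 x). *)
Lemma interior_iter (T : Type) (le : T -> T -> Prop) (rk : T -> nat)
    (f1 f2 : T -> T) (n : nat) :
  (forall x, le x x) ->
  (forall x y z, le x y -> le y z -> le x z) ->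
  (forall x y, le x y -> x = y \/ rk x < rk y) ->
  (forall x, rk x <= n) ->
  (forall x y, le x y -> le (f1 x) (f1 y)) ->
  (forall x y, le x y -> le (f2 x) (f2 y)) ->
  (forall x, le (f1 x) x) -> (forall x, le (f2 x) x) ->
  let g := iter n (f1 \o f2) in
  (forall x, g (f1 x) = g x) /\ (forall x, g (f2 x) = g x).
Proof.
move=> refl trans strict bnd m1 m2 d1 d2 g.
have anti x y : le x y -> le y x -> x = y.
  by move=> /strict[|a] // /strict[//|b]; lia.
have dec x : le ((f1 \o f2) x) x by apply: trans (d1 _) (d2 _).
have gf x : f1 (f2 (g x)) = g x.
  by apply: (iter_stable (rk := rk)) => // y; exact: strict.
have g2 x : f2 (g x) = g x.
  by apply: anti; [exact: d2 | rewrite -{1}gf; exact: d1].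
have g1 x : f1 (g x) = g x by rewrite -{1}g2 gf.
have gm x y : le x y -> le (g x) (g y).
  by move=> xy; rewrite /g; elim: (n) => //= m IH; apply/m1/m2.
have gd x : le (g x) x.
  rewrite /g; elim: (n) => //= m IH; exact: trans (dec _) IH.
have gg x : g (g x) = g x.
  by rewrite {1}/g; elim: (n) => //= m ->; exact: gf.
have H f (m : forall x y, le x y -> le (f x) (f y)) (d : forall x, le (f x) x)
   (fg : forall x, f (g x) = g x) x : g (f x) = g x.
  apply: anti; first exact/gm/d.
  by rewrite -gg; apply: gm; rewrite -fg; apply: m.
by split=> x; apply: H.
Qed.

(** * Posetal categories, and the levels of the objects of D *)

Definition posetal (C : smallcat) : Prop :=
  (forall f g : mor C, src f = src g -> tgt f = tgt g -> f = g) /\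
  (forall f g : mor C, src f = tgt g -> tgt f = src g -> src f = tgt f).

Lemma posetal_functor_ext (C D : smallcat) (F G : functor C D) :
  posetal D -> fob F =1 fob G -> F = G.
Proof.
move=> [thin _] e; apply: functor_ext => // f.
by apply: thin; rewrite ?src_fmap ?tgt_fmap e.
Qed.

Lemma posetal_ordcat N : posetal (ordcat N).
Proof.
split.
  move=> [[x y] /= xy] [[x' y'] /= xy']; rewrite /src /tgt /= => e1 e2.
  by apply: val_inj; rewrite /= e1 e2.
move=> [[x y] /= xy] [[x' y'] /= xy']; rewrite /src /tgt /= => e1 e2.
by subst; apply: val_inj; apply/eqP; rewrite eqn_leq xy xy'.
Qed.

Lemma posetal_sumcat (C D : fincat) : posetal C -> posetal D -> posetal (sumcat C D).
Proof.
move=> [C1 C2] [D1 D2]; split.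
  case=> f [g|g] // [e1] [e2]; [by rewrite (C1 f g)|by rewrite (D1 f g)].
by case=> f [g|g] // [e1] [e2]; [congr inl; apply: (C2 f g)|congr inr; apply: (D2 f g)].
Qed.

Lemma posetal_Ccat n K : posetal (Ccat n K).
Proof. by apply: posetal_sumcat => //; apply: posetal_ordcat. Qed.

Lemma posetal_adjoin (D : fincat) (H : finType) (b : H -> fobj D) :
  posetal D -> posetal (adjoin b).
Proof.
move=> [D1 D2]; split.
  case=> [f|[p|h]] [g|[q|h']] // [e1] [e2].
  - by rewrite (D1 f g).
  - congr (inr (inl _)); apply: val_inj; apply: injective_projections => //.
    apply: D1 => //.
    exact: etrans (eqP (valP p)) (etrans (congr1 b e2) (esym (eqP (valP q)))).
  - by rewrite e1.
by case=> [f|[p|h]] [g|[q|h']] // [e1] [e2]; congr inl; apply: (D2 f g).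
Qed.

Lemma posetal_Dcat n K : posetal (Dcat n K).
Proof.
elim: n => [|n IH]; first exact: posetal_ordcat.
exact: (@posetal_adjoin (Dcat n K)).
Qed.

Definition ord_arrow N (x y : 'I_N) (le : x <= y) : mor (ordcat N) := exist _ (x, y) le.

Lemma ord_functor_subproof N M (f : 'I_N -> 'I_M) (fm : ord_mono f) (p : ord_mor N) :
  f (val p).1 <= f (val p).2.
Proof. exact/fm/(valP p). Qed.

Definition ord_functor N M (f : 'I_N -> 'I_M) (fm : ord_mono f) :
  functor (ordcat N) (ordcat M).
Proof.
exists f (fun p => ord_arrow (ord_functor_subproof fm p)) => //.
- by move=> x; apply: val_inj.
- move=> g h e; apply: val_inj.
  by rewrite /cmp /= !val_ord_cmp //; congr (f _).
Defined.

Lemma functor_ord_mono N M (F : functor (ordcat N) (ordcat M)) : ord_mono (fob F).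
Proof.
move=> x y xy; have := valP (fmap F (ord_arrow xy)).
by have := src_fmap F (ord_arrow xy); have := tgt_fmap F (ord_arrow xy);
  rewrite /src /tgt /= => -> ->.
Qed.

(** The stars and 0 share the level 0: the objects of D_{n,k} of level 0 are then
    those of the base chain, and the level never decreases along a morphism. *)
Definition level n K (c : fobj (Ccat n K)) : nat := if c is inl i then i : nat else 0.

Definition base n K (i : 'I_K) : fobj (Dcat n K) := fob (Dbase n K) i.

Lemma base_inj n K : injective (@base n K).
Proof. by elim: n => //= n IH x y [/IH]. Qed.

Lemma mu_base n K (i : 'I_K) :
  mc_mu (base n i) = if insub (i : nat) is Some j then inr j else inl ord0.
Proof.
elim: n => [|n IH] //=; rewrite -/(base n i) IH.
by case: insubP => //= _; congr inl; apply: val_inj.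
Qed.

Lemma mu_base_last n K (i : 'I_K) : i.+1 = K -> mc_mu (base n i) = inl ord0.
Proof. by move=> e; rewrite mu_base insubF //; lia. Qed.

Lemma mu_base_star n K (j : 'I_K.-1) :
  mc_mu (base n (widen_ord (leq_pred K) j)) = inr j.
Proof. by rewrite mu_base insubT //= => lt; congr inr; apply: val_inj. Qed.

Lemma mu_base_zero n K (i : 'I_K) l : mc_mu (base n i) = inl l -> i.+1 = K.
Proof.
rewrite mu_base; case: insubP => // h _; have := ltn_ord i; lia.
Qed.

Lemma level_base n K (i : 'I_K) : level (mc_mu (base n i)) = 0.
Proof. by rewrite mu_base; case: insubP. Qed.

Lemma level_widen n K (c : fobj (Ccat n K)) : level (Cwiden c) = level c.
Proof. by case: c. Qed.

Lemma level_leq n K (c : fobj (Ccat n K)) : level c <= n.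
Proof. by case: c => //= i; rewrite -ltnS. Qed.

Lemma level0_base n K (x : fobj (Dcat n K)) :
  level (mc_mu x) = 0 -> exists i, x = base n i.
Proof.
elim: n x => [|n IH] x; first by exists x.
by case: x => //= x; rewrite level_widen => /IH[i ->]; exists i.
Qed.

Lemma star_base n K (x : fobj (Dcat n K)) j :
  mc_mu x = inr j -> x = base n (widen_ord (leq_pred K) j).
Proof.
move=> e; have [|i xi] := @level0_base n K x; first by rewrite e.
move: e; rewrite xi mu_base; case: insubP => // j' _ vj' [<-].
by congr base; apply: val_inj.
Qed.

(** The arrow adjoined for h starts at the source of h, which is an object of an
    earlier stage, and ends at an object of the current, highest level. *)
Lemma level_mono n K (f : mor (Dcat n K)) :
  level (mc_mu (src f : fobj (Dcat n K))) <= level (mc_mu (tgt f : fobj (Dcat n K))).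
Proof.
elim: n f => [|n IH]; first by move=> f; rewrite !(@level_base 0).
case=> [f|[p|h]] //.
  by rewrite /src /tgt /= !level_widen; exact: IH.
by rewrite /src /tgt /= level_widen; apply: leqW; exact: level_leq.
Qed.

Lemma Dcat_last n K : fobj (Dcat n K) -> exists z : 'I_K, z.+1 = K.
Proof.
elim: n => [|n IH]; first by move=> x; have [z [zK _]] := last_ord (x : 'I_K); exists z.
by case=> [/IH|h] //; apply: IH; exact: (@src (Dcat n K) (val h)).
Qed.

(** * The universal property of the brackets *)

Lemma mu_tgt (Y : rooted_action) (g : mor (acted Y)) : mu Y g = mu Y (idm (tgt g)).
Proof. by rewrite -{1}[g]cmp_idl mu_cmp // src_idm. Qed.

Lemma widen_mono n : ord_mono (widen_ord (leqnSn n)).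
Proof. by []. Qed.

Definition ord_restrict n (C : smallcat) (a : functor (ordcat n.+2) C) :
  functor (ordcat n.+1) C :=
  functor_comp a (ord_functor (@widen_mono n.+1)).

Definition top_edge n : mor (ordcat n.+2) :=
  ord_arrow (leqnSn n : widen_ord (leqnSn n.+1) (@ord_max n) <= @ord_max n.+1).

(** What a functor on D_{n,k} has to satisfy to extend to a map of rooted actions
    with first component a.  Compatibility with the action is only asked for the
    arrows p_{l,l+1}, which generate [n]; this is the form in which the freeness
    of each stage of D_{n,k} applies. *)
Definition equivariant n K (Y : rooted_action) (a : functor (ordcat n.+1) (acting Y))
    (F : functor (Dcat n K) (acted Y)) : Prop :=
  (forall (x : fobj (Dcat n K)) i, mc_mu x = inl i ->
     mu Y (idm (fob F x)) = fob a i) /\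
  (forall (h : fmor (Dcat n K)) (p : ord_mor n.+1),
     (val p).2 = (val p).1.+1 :> nat -> mc_mumor h = inl (val p).1 ->
     fmap F (step h) = act Y (fmap a p) (fmap F h)).

Lemma mu_equivariant n K Y a F (h : fmor (Dcat n K)) i :
  @equivariant n K Y a F -> mc_mumor h = inl i -> mu Y (fmap F h) = fob a i.
Proof. by move=> [Fo _] /Fo <-; rewrite mu_tgt tgt_fmap. Qed.

Lemma Cwiden_inl n K (c : fobj (Ccat n K)) i :
  Cwiden c = inl i -> exists2 j, c = inl j & i = widen_ord (leqnSn n.+1) j.
Proof. by case: c => //= j [<-]; exists j. Qed.

Lemma mc_mumor_inl n K (h : fmor (Dcat n K)) :
  @mc_mumor n.+1 K (Dcat n.+1 K) (inl h) = Cwiden (mc_mumor h).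
Proof. by []. Qed.

Lemma step_top n K (h : top_mor (Dcat n K)) :
  @step n.+1 K (inl (val h)) = gen (@top_src n K (Dcat n K)) h.
Proof. by rewrite /= valK. Qed.

Lemma step_inl n K (h : fmor (Dcat n K)) (i : 'I_n.+1) :
  mc_mumor h = inl i -> i < n -> @step n.+1 K (inl h) = inl (step h).
Proof.
move=> hi lt /=; case: insubP => // h' e _; move: e; rewrite hi => /eqP [E].
by rewrite E ltnn in lt.
Qed.

Lemma equivariant_restrict n K Y a (F : functor (Dcat n.+1 K) (acted Y)) :
  equivariant a F ->
  equivariant (ord_restrict a)
    (functor_comp F (adjoin_incl (@top_src n K (Dcat n K)))).
Proof.
move=> [F1 F2]; split.
  by move=> x i e /=; apply: (F1 (inl x)); rewrite /= e.
move=> h p e hp /=.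
have lt : (val p).1 < n by have := ltn_ord (val p).2; lia.
rewrite -(F2 (inl h)) //; last by rewrite mc_mumor_inl hp.
by rewrite (step_inl hp).
Qed.

Section Universal.
Variables (Y : rooted_action) (K : nat) (b : functor (ordcat K) (acted Y)).

(** The image of the generator adjoined for h is forced to be p_{n,n+1} acting on the
    image of h, and freeness of the adjunction says that this choice extends. *)
Lemma equivariant_exists n (a : functor (ordcat n.+1) (acting Y)) :
  (forall i : 'I_K, i.+1 = K -> mu Y (idm (fob b i)) = fob a ord0) ->
  exists F : functor (Dcat n K) (acted Y),
    functor_comp F (Dbase n K) = b /\ equivariant a F.
Proof.
elim: n a => [|n IH] a ab.
  exists b; split; first exact: functor_ext.
  split=> [x i e|h p]; last by rewrite (ord1 (val p).2).
  by rewrite (ord1 i); apply: ab; apply: (@mu_base_zero 0 K) e.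
have [|F0 [F0b F0a]] := IH (ord_restrict a).
  by move=> i /ab ->; congr (fob a _); apply: val_inj.
pose e (h : top_mor (Dcat n K)) := act Y (fmap a (top_edge n)) (fmap F0 (val h)).
have src_top (h : top_mor (Dcat n K)) :
    src (fmap a (top_edge n)) = mu Y (fmap F0 (val h)).
  by rewrite src_fmap (mu_equivariant F0a (eqP (valP h))).
have [|G [[GF Ge] _]] := @adjoin_free (Dcat n K) _ (@top_src n K (Dcat n K)) _ F0 e.
  by move=> h; rewrite /e src_act // src_fmap.
exists G; split; first by rewrite -F0b -GF; apply: functor_ext.
have Go (x : fobj (Dcat n K)) : fob G (inl x) = fob F0 x by rewrite -GF.
have Gm (h : fmor (Dcat n K)) : fmap G (inl h) = fmap F0 h by rewrite -GF.
split.
  case=> [x|h] i.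
    by move=> /Cwiden_inl[j xj ->]; rewrite Go (F0a.1 _ _ xj).
  move=> [<-]; rewrite -[inr h]/(tgt (gen (@top_src n K (Dcat n K)) h)).
  by rewrite -tgt_fmap -mu_tgt Ge mu_act // tgt_fmap.
case=> [h|h] p pe; last first.
  have -> : mc_mumor (inr h : fmor (Dcat n.+1 K)) = inl ord_max by case: h.
  by case=> E; have := ltn_ord (val p).2; rewrite pe -E ltnn.
rewrite mc_mumor_inl => /Cwiden_inl[j hj E].
have [jn|jn] := eqVneq j ord_max.
  have ht : mc_mumor h == inl ord_max by rewrite hj jn.
  rewrite -[h]/(val (exist _ h ht : top_mor (Dcat n K))) step_top Ge Gm.
  congr (act Y (fmap a _) _); apply/val_inj/injective_projections => /=.
    by rewrite E jn.
  by apply: val_inj; rewrite /= pe E jn.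
have lt : j < n.
  rewrite ltn_neqAle -ltnS ltn_ord andbT; apply: contra jn => /eqP jn.
  by apply/eqP/val_inj.
have p2 : (val p).2 < n.+1 by rewrite pe E.
have le : j <= Ordinal p2 by rewrite /= pe E; exact: leqnSn.
rewrite (step_inl hj) // !Gm (F0a.2 h (ord_arrow le)) //=; last by rewrite pe E.
congr (act Y (fmap a _) _); apply/val_inj/injective_projections => //=.
by apply: val_inj.
Qed.

Lemma equivariant_unique n (a : functor (ordcat n.+1) (acting Y))
    (F G : functor (Dcat n K) (acted Y)) :
  functor_comp F (Dbase n K) = functor_comp G (Dbase n K) ->
  equivariant a F -> equivariant a G -> F = G.
Proof.
elim: n a F G => [|n IH] a F G.
  have id0 (H : functor (Dcat 0 K) (acted Y)) : functor_comp H (Dbase 0 K) = H.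
    exact: functor_ext.
  by rewrite !id0.
move=> eb Fa Ga.
pose incl := adjoin_incl (@top_src n K (Dcat n K)).
have E : functor_comp F incl = functor_comp G incl.
  apply: (IH (ord_restrict a)); try exact: equivariant_restrict.
  apply: functor_ext.
    by move=> x; have := congr1 (fun H => fob H x) eb.
  by move=> x; have := congr1 (fun H => fmap H x) eb.
have gE (H : functor (Dcat n.+1 K) (acted Y)) (h : top_mor (Dcat n K)) : equivariant a H ->
    fmap H (gen (@top_src n K (Dcat n K)) h) =
    act Y (fmap a (top_edge n)) (fmap (functor_comp H incl) (val h)).
  move=> [_ H2]; rewrite -step_top (H2 _ (top_edge n)) //.
  by rewrite mc_mumor_inl (eqP (valP h)).
have [|H [_ U]] := @adjoin_free (Dcat n K) _ (@top_src n K (Dcat n K)) _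
   (functor_comp F incl) (fun h => fmap F (gen (@top_src n K (Dcat n K)) h)).
  by move=> h; rewrite src_fmap src_gen.
rewrite -(U F) // -(U G) //; split=> // h.
by rewrite !gE // E.
Qed.

(** The images of the stars are dictated by beta, since *_j is the moment of the
    vertex j of the base chain. *)
Lemma ra_mor_exists n (a : functor (ordcat n.+1) (acting Y)) :
  (forall i : 'I_K, i.+1 = K -> mu Y (idm (fob b i)) = fob a ord0) ->
  exists X : ra_mor (bracket n K) Y,
    functor_comp (ra_c X) (sum_inl (ordcat n.+1) (disccat 'I_K.-1)) = a /\
    functor_comp (ra_d X) (Dbase n K) = b.
Proof.
move=> ab; have [F [Fb Fa]] := equivariant_exists ab.
pose star (j : 'I_K.-1) : obj (acting Y) :=
  mu Y (idm (fob b (widen_ord (leq_pred K) j))).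
have [c [ci cs cmi cms]] : exists c : functor (Ccat n K) (acting Y),
   [/\ forall i, fob c (inl i) = fob a i, forall j, fob c (inr j) = star j,
       forall p, fmap c (inl p) = fmap a p & forall j, fmap c (inr j) = idm (star j)].
  unshelve eexists (@Functor (Ccat n K) (acting Y)
    (fun x => match x with inl i => fob a i | inr j => star j end)
    (fun f => match f with inl p => fmap a p | inr j => idm (star j) end) _ _ _ _) => //.
  - by case=> [p|j]; rewrite ?(src_fmap a) ?src_idm.
  - by case=> [p|j]; rewrite ?(tgt_fmap a) ?tgt_idm.
  - by case=> [p|j] //; rewrite -(fmap_idm a).
  - case=> [p|j] [q|k] //= [e]; first by rewrite -fmap_cmp.
    have -> : j = k by [].
    by have := cmp_idl (idm (star k)); rewrite tgt_idm => ->.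
have muF (x : fobj (Dcat n K)) : mu Y (idm (fob F x)) = fob c (mc_mu x).
  case E: (mc_mu x) => [i|j]; first by rewrite ci; apply: Fa.1.
  by rewrite cs (star_base E) /star -Fb.
have muFm (g : fmor (Dcat n K)) : mu Y (fmap F g) = fob c (mc_mumor g).
  by rewrite mu_tgt tgt_fmap muF.
unshelve eexists (@RAMor (bracket n K) Y c F _ _).
- by move=> g; rewrite muFm.
- case=> [p|j] g /= e; last first.
    have {}e : inr j = mc_mumor g by [].
    by rewrite cms -(cs j) e -muFm act_idm.
  rewrite cmi; have [m pm] : exists m, (val p).2 = (val p).1 + m :> nat.
    by exists ((val p).2 - (val p).1); rewrite subnKC //; exact: (valP p).
  have {}e : mc_mumor g = inl (val p).1 by [].
  rewrite pm addKn; elim: m p e pm => [|m IH] p e pm.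
    have -> : p = @idm (ordcat n.+1) (val p).1.
      apply/val_inj/injective_projections => //=; apply: val_inj.
      by rewrite /= pm addn0.
    by rewrite fmap_idm -ci -e -muFm act_idm.
  have qn : (val p).1 + m < n.+1 by have := ltn_ord (val p).2; lia.
  have le : (val p).1 <= Ordinal qn by exact: leq_addr.
  pose q := ord_arrow le; have le' : Ordinal qn <= (val p).2.
    by rewrite /= pm leq_add2l.
  have -> : p = @cmp (ordcat n.+1) (ord_arrow le') q.
    by apply/val_inj; rewrite /cmp /= val_ord_cmp //=; case: (val p).
  have qF : src (fmap a q) = mu Y (fmap F g) by rewrite src_fmap muFm e ci.
  rewrite fmap_cmp // act_cmp // ?src_fmap ?tgt_fmap // -IH // iterS.
  rewrite (Fa.2 _ (ord_arrow le')) //=; first by rewrite pm addnS.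
  by have [_] := iter_step_spec (j := Ordinal qn) e le; rewrite /= addKn.
split; last exact: Fb.
by apply: functor_ext.
Qed.

End Universal.

Lemma ra_equivariant Y n K (X : ra_mor (bracket n K) Y) :
  equivariant (functor_comp (ra_c X) (sum_inl (ordcat n.+1) (disccat 'I_K.-1)))
     (ra_d X).
Proof.
split.
  move=> x i e; rewrite -(fmap_idm (ra_d X)) ra_mu /=.
  by rewrite /mc_mumor (@tgt_idm (Dcat n K)) e.
move=> h p pe hp; rewrite /= -(ra_act X (f := inl p)) //=.
by rewrite pe subSnn.
Qed.

Lemma ra_mor_eq Y n K (X X' : ra_mor (bracket n K) Y) :
  functor_comp (ra_c X) (sum_inl (ordcat n.+1) (disccat 'I_K.-1)) =
  functor_comp (ra_c X') (sum_inl (ordcat n.+1) (disccat 'I_K.-1)) ->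
  functor_comp (ra_d X) (Dbase n K) = functor_comp (ra_d X') (Dbase n K) ->
  X = X'.
Proof.
move=> ea eb.
have ed : ra_d X = ra_d X'.
  by apply: equivariant_unique eb (ra_equivariant X) _; rewrite ea; exact: ra_equivariant.
apply: (ra_mor_ext _ ed).
have eo : fob (ra_c X) =1 fob (ra_c X').
  case=> [i|j]; first exact: (congr1 (fun H : functor (ordcat n.+1) (acting Y) => fob H i) ea).
  pose x := base n (widen_ord (leq_pred K) j).
  have mx : mu (bracket n K) (@idm (Dcat n K) x) = inr j.
    by rewrite /= /mc_mumor (@tgt_idm (Dcat n K)) mu_base_star.
  by rewrite -mx -!ra_mu ed.
apply: functor_ext => //.
case=> [p|j]; first exact: (congr1 (fun H : functor (ordcat n.+1) (acting Y) => fmap H p) ea).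
rewrite -[inr j]/(@idm (Ccat n K) (inr j)) !fmap_idm; congr idm; exact: eo.
Qed.

(** * Injectivity on the objects of D *)

Lemma posetal_convex N (C : smallcat) (F : functor (ordcat N) C) :
  posetal C -> forall x y z : 'I_N, x <= y <= z -> fob F x = fob F z -> fob F x = fob F y.
Proof.
move=> [_ anti] x y z /andP[xy yz] e.
have := anti (fmap F (ord_arrow xy)) (fmap F (ord_arrow yz)).
by rewrite !src_fmap !tgt_fmap; apply.
Qed.

Lemma inl_arrow n K (f : mor (Ccat n K)) i j :
  src f = inl i -> tgt f = inl j -> (i <= j)%N.
Proof. by case: f => [p|k] // [<-] [<-]; exact: (valP p). Qed.

Lemma arrow_src_inl n K (f : mor (Ccat n K)) j :
  tgt f = inl j -> exists i, src f = inl i.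
Proof. by case: f => [p|k] // _; eexists. Qed.

Lemma arrow_tgt_inl n K (f : mor (Ccat n K)) i :
  src f = inl i -> exists j, tgt f = inl j.
Proof. by case: f => [p|k] // _; eexists. Qed.

Lemma base_arrow n K (f : mor (Dcat n K)) i j :
  src f = base n i -> tgt f = base n j -> (i <= j)%N.
Proof.
elim: n f => [|n IH].
  by move=> f; rewrite /src /tgt /base /= => <- <-; exact: (valP f).
by case=> [f|[p|h]] // [e1] [e2]; exact: (IH f).
Qed.

(** At the stage where step h is a generator, its target is a new object which
    remembers h. *)
Lemma step_tgt_inj n K (h h' : mor (Dcat n K)) (l : 'I_n.+1) :
  mc_mumor h = inl l -> mc_mumor h' = inl l -> l < n ->
  tgt (step h : mor (Dcat n K)) = tgt (step h' : mor (Dcat n K)) -> h = h'.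
Proof.
elim: n h h' l => [|n IH] h h' l; first by rewrite ltn0.
have ninr x : @mc_mumor n.+1 K (Dcat n.+1 K) (inr x) = inl ord_max by case: x.
case: h => [h|h]; last by rewrite ninr => -[<-] /=; rewrite ltnn.
case: h' => [h'|h']; last by rewrite ninr => _ [<-] /=; rewrite ltnn.
rewrite !mc_mumor_inl => /Cwiden_inl[i hi ->] /Cwiden_inl[i' hi' /(congr1 val)/= E].
have {i' E}hi' : mc_mumor h' = inl i by rewrite hi'; congr inl; exact: val_inj.
move=> _; have [ei|ei] := eqVneq i ord_max.
  have ht : mc_mumor h == inl ord_max by rewrite hi ei.
  have ht' : mc_mumor h' == inl ord_max by rewrite hi' ei.
  have := step_top (exist _ h ht : top_mor (Dcat n K)) => /= ->.
  have := step_top (exist _ h' ht' : top_mor (Dcat n K)) => /= ->.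
  by case=> ->.
have lt : i < n.
  rewrite ltn_neqAle -ltnS ltn_ord andbT; apply: contra ei => /eqP ei.
  by apply/eqP/val_inj.
move=> E; congr inl; apply: (IH _ _ i) => //.
have inl_inj (x y : fobj (Dcat n K)) : @inl _ (top_mor (Dcat n K)) x = inl y -> x = y by case.
apply: inl_inj; exact: etrans (etrans (congr1 (@tgt (Dcat n.+1 K)) (esym (step_inl hi lt))) E)
  (congr1 (@tgt (Dcat n.+1 K)) (step_inl hi' lt)).
Qed.

Lemma iter_step_tgt_inj n K (h h' : mor (Dcat n K)) (i : 'I_n.+1) m :
  mc_mumor h = inl i -> mc_mumor h' = inl i -> i + m.+1 <= n ->
  tgt (iter m.+1 (@step n K) h : mor (Dcat n K)) =
  tgt (iter m.+1 (@step n K) h' : mor (Dcat n K)) -> h = h'.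
Proof.
move=> hi hi'; elim: m => [|m IH] le.
  by apply: (step_tgt_inj hi hi'); lia.
have jn : i + m.+1 < n.+1 by lia.
have ij : i <= Ordinal jn by exact: leq_addr.
have [_] := iter_step_spec hi ij; have [_] := iter_step_spec hi' ij.
rewrite /= -/(iter m.+1 _ h) -/(iter m.+1 _ h') addKn => e' e.
move/(@step_tgt_inj n K _ _ (Ordinal jn)) => H; apply: IH; first lia.
by rewrite H //=; lia.
Qed.

(** Objects of the last stage have distinct images by injectivity of the action.
    They cannot collide with the images of older objects, whose moments differ,
    except perhaps with the image of a vertex j < k of the base chain, as its
    moment *_j may be sent into [m].  But beta(j) lies below beta(k), so its
    level is at most the level of alpha(0), which is below that of alpha(n). *)
Lemma equivariant_inj m L n K (a : functor (ordcat n.+1) (Ccat m L))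
    (F : functor (Dcat n K) (Dcat m L)) :
  @equivariant n K (bracket m L) a F ->
  injective (fob a) -> injective (fun i => fob F (base n i)) -> injective (fob F).
Proof.
elim: n a F => [|n IH] a F Fa ia ib; first exact: ib.
have Fr := equivariant_restrict Fa.
have {IH} FI := IH _ _ Fr _ ib; set a' := ord_restrict a in Fr FI.
have {}FI : injective (fun x : fobj (Dcat n K) => fob F (inl x)).
  by apply: FI => x y /ia [] /val_inj.
have ne : src (fmap a (top_edge n)) <> tgt (fmap a (top_edge n)).
  by rewrite src_fmap tgt_fmap => /ia /(congr1 val) /= /n_Sn.
have [p pE plt] : exists2 p, fmap a (top_edge n) = inl p & (val p).1 < (val p).2.
  case: (fmap a (top_edge n)) ne => [p|//] ne; exists p => //.
  rewrite ltn_neqAle (valP p) andbT; apply/eqP => e; apply: ne.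
  by congr inl; apply: val_inj.
have pmax : fob a ord_max = inl (val p).2.
  by rewrite -[ord_max]/(tgt (top_edge n)) -tgt_fmap pE.
have pprev : fob a (widen_ord (leqnSn _) ord_max) = inl (val p).1.
  by rewrite -[widen_ord _ _]/(src (top_edge n)) -src_fmap pE.
have Fgen (h : top_mor (Dcat n K)) :
    fmap F (gen (@top_src n K (Dcat n K)) h) =
    iter ((val p).2 - (val p).1) (@step m L) (fmap F (inl (val h))).
  rewrite -step_top (Fa.2 _ (top_edge n)) ?pE //.
  by rewrite mc_mumor_inl (eqP (valP h)).
have mixed (x : fobj (Dcat n K)) (h : top_mor (Dcat n K)) :
    fob F (inl x) <> fob F (inr h).
  move=> e; have := Fa.1 (inr h) ord_max erefl; rewrite -e.
  case E: (mc_mu x) => [i|j].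
    rewrite (Fa.1 (inl x) (widen_ord (leqnSn _) i)); last by rewrite /= E.
    by move/ia/(congr1 val) => /= /eqP; rewrite ltn_eqF.
  have [z zK] := Dcat_last x; pose i := widen_ord (leq_pred K) j.
  have iz : i <= z by have := ltn_ord i; lia.
  have := level_mono (fmap F (fmap (Dbase n.+1 K) (ord_arrow iz))).
  rewrite !src_fmap !tgt_fmap -[fob (Dbase _ _) _]/(inl (base n i)) -(star_base E).
  have muE (y : fobj (Dcat m L)) : mu (bracket m L) (@idm (Dcat m L) y) = mc_mu y.
    by rewrite /= /mc_mumor (@tgt_idm (Dcat m L)).
  rewrite muE => le e'; move: le; rewrite e' pmax /=.
  rewrite -(muE (fob F _)) (Fa.1 _ ord0); last exact: mu_base_last.
  pose q := ord_arrow (leq0n _ : ord0 <= widen_ord (leqnSn _) (@ord_max n)).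
  have q2 : tgt (fmap a q) = inl (val p).1 by rewrite tgt_fmap -pprev.
  have [l q1] := arrow_src_inl q2; have := inl_arrow q1 q2.
  have -> : fob a ord0 = inl l by rewrite -q1 src_fmap.
  move=> /= le1 le2; move: plt; rewrite ltnNge => /negP; apply; exact: leq_trans le2 le1.
case=> [x|h] [y|h'] e.
- by rewrite (FI _ _ e).
- by case: (mixed _ _ e).
- by case: (mixed _ _ (esym e)).
have : fmap F (inl (val h)) = fmap F (inl (val h')).
  have muh (k : top_mor (Dcat n K)) : mc_mumor (fmap F (inl (val k))) = inl (val p).1.
    have := @mu_equivariant n.+1 K (bracket m L) a F (inl (val k)) _ Fa.
    by rewrite mc_mumor_inl (eqP (valP k)) => /(_ _ erefl); rewrite pprev.
  have [d dE] : exists d, (val p).2 - (val p).1 = d.+1.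
    by exists ((val p).2 - (val p).1).-1; lia.
  apply: (@iter_step_tgt_inj m L _ _ (val p).1 d) => //.
    by have := ltn_ord (val p).2; lia.
  by rewrite -dE -!Fgen !tgt_fmap.
move=> E; congr inr; apply: val_inj.
apply: (posetal_Dcat n K).1; apply: FI.
  by have := congr1 (@src (Dcat m L)) E; rewrite !src_fmap.
by have := congr1 (@tgt (Dcat m L)) E; rewrite !tgt_fmap.
Qed.

(** * Simplicial maps *)

Lemma hom_eq (a b : DeltaDelta) (X X' : hom a b) :
  fob (alpha X) =1 fob (alpha X') -> fob (beta X) =1 fob (beta X') -> X = X'.
Proof.
move=> ea eb; apply: ra_mor_eq.
  by apply: posetal_functor_ext => //; apply: posetal_Ccat.
by apply: posetal_functor_ext => //; apply: posetal_Dcat.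
Qed.

Lemma hom_exists (a b : DeltaDelta)
    (f : functor (ordcat (dd_n a).+1) (Ccat (dd_n b) (dd_K b)))
    (g : functor (ordcat (dd_K a)) (Dcat (dd_n b) (dd_K b))) :
  (forall i : 'I_(dd_K a), i.+1 = dd_K a -> mc_mu (fob g i : fobj (Dcat _ _)) = fob f ord0) ->
  exists X : hom a b, alpha X = f /\ beta X = g.
Proof.
move=> fg; have [|X [Xf Xg]] :=
  @ra_mor_exists (bracket (dd_n b) (dd_K b)) (dd_K a) g (dd_n a) f; last by exists X.
by move=> i /fg <-; rewrite /= /mc_mumor (@tgt_idm (Dcat _ _)).
Qed.

Lemma mu_ra_d (a b : DeltaDelta) (X : hom a b) (x : fobj (Dcat (dd_n a) (dd_K a))) :
  mc_mu (fob (ra_d X) x : fobj (Dcat (dd_n b) (dd_K b))) = fob (ra_c X) (mc_mu x).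
Proof.
have := ra_mu X (@idm (Dcat (dd_n a) (dd_K a)) x).
by rewrite fmap_idm /= /mc_mumor !(@tgt_idm (Dcat _ _)).
Qed.

Lemma mu_beta_last (a b : DeltaDelta) (X : hom a b) (i : 'I_(dd_K a)) :
  i.+1 = dd_K a ->
  mc_mu (fob (beta X) i : fobj (Dcat (dd_n b) (dd_K b))) = fob (alpha X) ord0.
Proof. by move=> e; rewrite [LHS](mu_ra_d X (base _ i)) mu_base_last. Qed.

(** Maps which preserve the chains [n] and [k]; on these, a map of rooted actions is
    just a pair of monotone maps of ordinals. *)
Definition simplicial (a b : DeltaDelta) (X : hom a b)
    (f : 'I_(dd_n a).+1 -> 'I_(dd_n b).+1) (g : 'I_(dd_K a) -> 'I_(dd_K b)) : Prop :=
  (forall i, fob (alpha X) i = inl (f i)) /\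
  (forall i, fob (beta X) i = base (dd_n b) (g i)).

Lemma simplicial_id (a : DeltaDelta) : simplicial (hid a) id id.
Proof. by []. Qed.

Lemma alpha_comp (a b c : DeltaDelta) (Y : hom b c) (X : hom a b) i j :
  fob (alpha X) i = inl j -> fob (alpha (hcomp Y X)) i = fob (alpha Y) j.
Proof. by move=> e; rewrite -[LHS]/(fob (ra_c Y) (fob (alpha X) i)) e. Qed.

Lemma beta_comp (a b c : DeltaDelta) (Y : hom b c) (X : hom a b) i j :
  fob (beta X) i = base _ j -> fob (beta (hcomp Y X)) i = fob (beta Y) j.
Proof. by move=> e; rewrite -[LHS]/(fob (ra_d Y) (fob (beta X) i)) e. Qed.

Lemma simplicial_comp (a b c : DeltaDelta) (Y : hom b c) (X : hom a b) f g f' g' :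
  simplicial X f g -> simplicial Y f' g' -> simplicial (hcomp Y X) (f' \o f) (g' \o g).
Proof.
move=> [X1 X2] [Y1 Y2]; split=> i; first by rewrite (alpha_comp _ (X1 i)).
by rewrite (beta_comp _ (X2 i)).
Qed.

Lemma simplicial_eq (a b : DeltaDelta) (X X' : hom a b) f g f' g' :
  simplicial X f g -> simplicial X' f' g' -> f =1 f' -> g =1 g' -> X = X'.
Proof.
move=> [X1 X2] [Y1 Y2] ef eg.
by apply: hom_eq => i; rewrite ?X1 ?Y1 ?X2 ?Y2 ?ef ?eg.
Qed.

Lemma simplicial_exists (a b : DeltaDelta)
    (f : 'I_(dd_n a).+1 -> 'I_(dd_n b).+1) (g : 'I_(dd_K a) -> 'I_(dd_K b)) :
  ord_mono f -> ord_mono g -> f ord0 = ord0 ->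
  (forall i : 'I_(dd_K a), i.+1 = dd_K a -> (g i).+1 = dd_K b) ->
  exists X : hom a b, simplicial X f g.
Proof.
move=> fm gm f0 gl.
have [|X [Xa Xb]] := @hom_exists a b
   (functor_comp (sum_inl (ordcat (dd_n b).+1) (disccat 'I_(dd_K b).-1)) (ord_functor fm))
   (functor_comp (Dbase (dd_n b) (dd_K b)) (ord_functor gm)).
  move=> i e; change (mc_mu (base (dd_n b) (g i)) = inl (f ord0)).
  by rewrite f0 mu_base_last //; exact: gl.
by exists X; split=> i; rewrite ?Xa ?Xb.
Qed.

(** Since 0 is hit by alpha and [n] is connected, alpha stays in [m] and
    alpha(0) = 0.  So beta(k) has moment 0, which only the last vertex l of the
    base chain has; everything below it is in the base chain as well.  The stars
    *_j of the target are not hit by alpha, so the vertices j < l can only be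
    images of vertices of the base chain. *)
Lemma minus_simplicial (a b : DeltaDelta) (X : hom a b) : DDminus X ->
  exists f g, [/\ simplicial X f g, ord_mono f, ord_mono g, surj f & surj g].
Proof.
move=> [Xc Xd].
have arr (i j : 'I_(dd_n a).+1) : i <= j -> exists h : mor (Ccat (dd_n b) (dd_K b)),
    src h = fob (alpha X) i /\ tgt h = fob (alpha X) j.
  by move=> ij; exists (fmap (alpha X) (ord_arrow ij)); rewrite src_fmap tgt_fmap.
have brr (i j : 'I_(dd_K a)) : i <= j -> exists h : mor (Dcat (dd_n b) (dd_K b)),
    src h = fob (beta X) i /\ tgt h = fob (beta X) j.
  by move=> ij; exists (fmap (beta X) (ord_arrow ij)); rewrite src_fmap tgt_fmap.
have [i0 Xi0] := Xc ord0.
have Xf i : exists j, fob (alpha X) i = inl j.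
  case: (leqP i i0) => [|/ltnW] /arr[h [hs ht]].
    by rewrite -hs; apply: (arrow_src_inl (j := ord0)); rewrite ht.
  by rewrite -ht; apply: (arrow_tgt_inl (i := ord0)); rewrite hs.
have [f fE] := fin_all_exists Xf.
have fm : ord_mono f.
  move=> i j /arr[h [hs ht]].
  by apply: (@inl_arrow _ _ h); rewrite ?hs ?ht fE.
have fs : surj f.
  by move=> j; have [i] := Xc j; rewrite fE => -[<-]; exists i.
have f0 : f ord0 = ord0 by apply: ord_mono_surj_zero.
have mu_last (i : 'I_(dd_K a)) : i.+1 = dd_K a ->
    mc_mu (fob (beta X) i : fobj (Dcat (dd_n b) (dd_K b))) = inl ord0.
  by move=> e; rewrite mu_beta_last // fE f0.
have Xg (i : 'I_(dd_K a)) : exists j, fob (beta X) i = base (dd_n b) j.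
  have [z [zK le]] := last_ord i.
  apply: level0_base; apply/eqP; rewrite -leqn0.
  have [h [<- ht]] := brr _ _ le; apply: leq_trans (level_mono h) _.
  by rewrite ht mu_last.
have [g gE] := fin_all_exists Xg.
have gm : ord_mono g.
  move=> i j /brr[h [hs ht]].
  by apply: (@base_arrow _ _ h); rewrite ?hs ?ht gE.
have gs : surj g.
  move=> j; have [x Xx] := Xd (base (dd_n b) j).
  have : mc_mu (base (dd_n b) j) = fob (ra_c X) (mc_mu (x : fobj (Dcat (dd_n a) (dd_K a)))).
    by rewrite -mu_ra_d Xx.
  case E: (mc_mu (x : fobj (Dcat _ _))) => [i|k] mj; last first.
    exists (widen_ord (leq_pred _) k); apply: (@base_inj (dd_n b)).
    by rewrite -gE -Xx (star_base E).
  have {}mj : mc_mu (base (dd_n b) j) = inl (f i) by rewrite mj -fE.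
  have [z zK] := Dcat_last x; exists z; apply: val_inj; apply: succn_inj.
  have := mu_last z zK; rewrite gE => /mu_base_zero ->.
  by rewrite (mu_base_zero mj).
by exists f, g.
Qed.

(** The section of alpha must send 0 to 0 and that of beta must send the last vertex
    to the last vertex, whence the opposite choices of preimages. *)
Lemma minus_section (a b : DeltaDelta) (X : hom a b) f g :
  simplicial X f g -> ord_mono f -> ord_mono g -> surj f -> surj g ->
  exists (S : hom b a) (f' : 'I_(dd_n b).+1 -> 'I_(dd_n a).+1)
      (g' : 'I_(dd_K b) -> 'I_(dd_K a)),
    [/\ simplicial S f' g', ord_mono f', ord_mono g', hcomp X S = hid b &
        (forall i : 'I__, (f' (f i) <= i)%N) /\ (forall i : 'I__, (i <= g' (g i))%N)].
Proof.
move=> Xfg fm gm fs gs.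
have [f' [f'm f'K f'le]] := min_section fm fs.
have [g' [g'm g'K g'le]] := max_section gm gs.
have f'0 := min_section_zero fm fs f'le.
have [|S Sfg] := simplicial_exists f'm g'm f'0.
  by move=> i; apply: max_section_last gm gs g'le.
exists S, f', g'; split=> //.
by apply: simplicial_eq (simplicial_comp Sfg Xfg) (simplicial_id b) _ _.
Qed.

Lemma simplicial_minus (a b : DeltaDelta) (X : hom a b) f g :
  simplicial X f g -> ord_mono f -> ord_mono g -> surj f -> surj g -> DDminus X.
Proof.
move=> Xfg fm gm fs gs; split.
  by move=> j; have [i <-] := fs j; exists i; exact: Xfg.1.
have [S [_ [_ [_ _ _ XS _]]]] := minus_section Xfg fm gm fs gs.
by move=> y; exists (fob (ra_d S) y); rewrite -[LHS]/(fob (ra_d (hcomp X S)) y) XS.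
Qed.

Lemma plus_inj (a b : DeltaDelta) (X : hom a b) : DDplus X -> injective (fob (ra_d X)).
Proof.
move=> [Xc Xd]; apply: (@equivariant_inj _ _ _ _ (alpha X)) => //.
exact: (ra_equivariant X).
Qed.

(** * The Reedy structure *)

Lemma plus_minus_identity (a b : DeltaDelta) (X : hom a b) :
  DDplus X -> DDminus X -> is_identity X.
Proof.
move=> [Xc Xd] /minus_simplicial[f [g [Xfg fm gm fs gs]]].
have fi : injective f by move=> x y e; apply: Xc; rewrite !Xfg.1 e.
have gi : injective g by move=> x y e; apply: Xd; rewrite !Xfg.2 e.
have en : dd_n a = dd_n b.
  have := leq_card f fi; have := card_surj fs; rewrite !card_ord; lia.
have eK : dd_K a = dd_K b.
  have := leq_card g gi; have := card_surj gs; rewrite !card_ord; lia.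
case: a b X f g en eK Xfg fm gm {fs gs Xc Xd} fi gi => n K [m L] X f g /= en eK.
subst => Xfg fm gm fi gi.
suff -> : X = hid (DDIndex m L : DeltaDelta) by constructor.
apply: simplicial_eq Xfg (simplicial_id _) _ _.
  exact: ord_mono_inj_id.
exact: ord_mono_inj_id.
Qed.

(** An injective functor cannot send a nonidentity arrow to the identity of a star. *)
Lemma plus_alpha_inl (a b : DeltaDelta) (X : hom a b) : DDplus X -> 0 < dd_n a ->
  exists f, injective f /\ forall i, fob (alpha X) i = inl (f i).
Proof.
move=> [Xc _] n0.
have arr (i j : 'I_(dd_n a).+1) : i < j -> exists p, src (inl p : mor (Ccat _ _)) = fob (alpha X) i
    /\ tgt (inl p : mor (Ccat _ _)) = fob (alpha X) j.
  move=> ij; have le := ltnW ij; pose h := fmap (alpha X) (ord_arrow le).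
  have hs : src h = fob (alpha X) i by rewrite src_fmap.
  have ht : tgt h = fob (alpha X) j by rewrite tgt_fmap.
  case: h hs ht => [p|k] hs ht; first by exists p.
  have : fob (alpha X) i = fob (alpha X) j by rewrite -hs -ht.
  by move=> /Xc e; rewrite e ltnn in ij.
have Xf i : exists j, fob (alpha X) i = inl j.
  have [i0|i0] := posnP i.
    have : (i < (ord_max : 'I_(dd_n a).+1)) by rewrite i0.
    by move=> /arr[p [<- _]]; eexists.
  have : ((ord0 : 'I_(dd_n a).+1) < i) by [].
  by move=> /arr[p [_ <-]]; eexists.
have [f fE] := fin_all_exists Xf; exists f; split=> // x y e.
by apply: Xc; rewrite !fE e.
Qed.

Lemma minus_comp (a b c : DeltaDelta) (Y : hom b c) (X : hom a b) :
  DDminus Y -> DDminus X -> DDminus (hcomp Y X).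
Proof.
move=> [Yc Yd] [Xc Xd]; split; last exact: (surj_comp Yd Xd).
move=> j; have [k Yk] := Yc j; have [i Xi] := Xc k.
by exists i; rewrite (alpha_comp Y Xi).
Qed.

Lemma plus_comp (a b c : DeltaDelta) (Y : hom b c) (X : hom a b) :
  DDplus Y -> DDplus X -> DDplus (hcomp Y X).
Proof.
move=> Yp Xp; have Yi := plus_inj Yp; have [Yc _] := Yp; have [Xc Xd] := Xp.
split; last by move=> x y /Yi/Xd.
have [n0|n0] := posnP (dd_n a).
  have only0 (i : 'I_(dd_n a).+1) : i = ord0.
    by apply: val_inj => /=; have := ltn_ord i; lia.
  by move=> x y _; rewrite (only0 x) (only0 y).
have [f [fi fE]] := plus_alpha_inl Xp n0.
by move=> x y; rewrite !(alpha_comp Y (fE _)) => /Yc/fi.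
Qed.

Lemma plus_cancel (a b c : DeltaDelta) (Y : hom b c) (X : hom a b) :
  DDplus (hcomp Y X) -> DDplus X.
Proof.
move=> [c1 d1]; split.
  by move=> x y e; apply: c1; exact: (congr1 (fob (ra_c Y)) e).
by move=> x y e; apply: d1; exact: (congr1 (fob (ra_d Y)) e).
Qed.

Lemma minus_cancel (a b c : DeltaDelta) (Y : hom b c) (X : hom a b) :
  DDminus X -> DDminus (hcomp Y X) -> DDminus Y.
Proof.
move=> /minus_simplicial[f [g [[Xf _] _ _ _ _]]] [c1 d1]; split.
  by move=> j; have [i] := c1 j; rewrite (alpha_comp Y (Xf i)); exists (f i).
by move=> y; have [x] := d1 y; exists (fob (ra_d X) x).
Qed.

(** Direct maps are not monic in general, as they may identify two stars; they can
    be cancelled against maps whose first component avoids the stars. *)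
Lemma plus_monic (z a b : DeltaDelta) (Y : hom a b) (X X' : hom z a) f g f' g' :
  DDplus Y -> simplicial X f g -> simplicial X' f' g' ->
  hcomp Y X = hcomp Y X' -> X = X'.
Proof.
move=> [Yc Yd] S S' e; apply: (simplicial_eq S S').
  by move=> i; apply: Yc; rewrite -(alpha_comp Y (S.1 i)) -(alpha_comp Y (S'.1 i)) e.
by move=> i; apply: Yd; rewrite -(beta_comp Y (S.2 i)) -(beta_comp Y (S'.2 i)) e.
Qed.

(** The middle object is given by the images of alpha and beta.  The direct part is
    the restriction of (alpha, beta) along sections of the quotients onto these
    images, chosen so as to preserve the condition linking alpha(0) and beta(k). *)
Lemma factor_exists (a b : DeltaDelta) (X : hom a b) :
  exists (c : DeltaDelta) (e : hom a c) (m : hom c b),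
    [/\ DDminus e, DDplus m & X = hcomp m e].
Proof.
have [P [s [sm ss sE]]] := @image_factor (fobj (Ccat (dd_n b) (dd_K b))) _ _
  (@posetal_convex _ _ (alpha X) (posetal_Ccat _ _)).
have [Q [t [tm ts tE]]] := @image_factor (fobj (Dcat (dd_n b) (dd_K b))) _ _
  (@posetal_convex _ _ (beta X) (posetal_Dcat _ _)).
case: P s sm ss sE => [|P] s sm ss sE; first by case: (s ord0).
have [s' [s'm s'K s'le]] := min_section sm ss.
have [t' [t'm t'K t'le]] := max_section tm ts.
pose c : DeltaDelta := DDIndex P Q.
have s0 := ord_mono_surj_zero sm ss.
have [e es] := @simplicial_exists a c s t sm tm s0 (fun i => ord_mono_surj_last tm ts).
have [|m [ma mb]] := @hom_exists c b (functor_comp (alpha X) (ord_functor s'm))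
   (functor_comp (beta X) (ord_functor t'm)).
  move=> i iQ.
  change (mc_mu (fob (beta X) (t' i) : fobj (Dcat (dd_n b) (dd_K b))) = fob (alpha X) (s' ord0)).
  rewrite mu_beta_last; first by rewrite (min_section_zero sm ss s'le).
  exact: max_section_last tm ts t'le iQ.
exists c, e, m; split; first exact: simplicial_minus es _ _ _ _.
  split; rewrite ?ma ?mb.
    by move=> x y /sE; rewrite !s'K.
  by move=> x y /tE; rewrite !t'K.
apply: hom_eq => i.
  by rewrite (alpha_comp m (es.1 i)) ma; apply/sE; rewrite s'K.
by rewrite (beta_comp m (es.2 i)) mb; apply/tE; rewrite t'K.
Qed.

(** If the degree does not drop, the surjections on [n] and on the objects of
    D_{n,k} are bijections, and the map is also direct. *)
Lemma minus_deg (a b : DeltaDelta) (X : hom a b) :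
  DDminus X -> ~ is_identity X -> DDdeg b < DDdeg a.
Proof.
move=> Xm nid; have [f [g [[Xf Xg] fm gm fs gs]]] := minus_simplicial Xm.
have le1 : dd_n b <= dd_n a by have := card_surj fs; rewrite !card_ord.
have ds : @surj (fobj (Dcat (dd_n a) (dd_K a))) (fobj (Dcat (dd_n b) (dd_K b))) (fob (ra_d X)).
  exact: Xm.2.
have le2 := card_surj ds; rewrite /DDdeg ltnNge; apply/negP => le.
apply: nid; apply: plus_minus_identity => //; split.
  have fi : injective f by apply: card_surj_inj fs _; rewrite !card_ord; lia.
  by move=> x y; rewrite !Xf => -[/fi].
have di := card_surj_inj ds; move=> x y /di => /(_ ltac:(lia)); exact: base_inj.
Qed.

(** Dually, if the degree does not grow, the injections on [n] and on the objects of
    D_{n,k} are bijections, and the map is also inverse.  The case n = 0 is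
    special: there alpha is injective even when its value is a star. *)
Lemma plus_deg (a b : DeltaDelta) (X : hom a b) :
  DDplus X -> ~ is_identity X -> DDdeg a < DDdeg b.
Proof.
move=> Xp nid.
have di : @injective (fobj (Dcat (dd_n b) (dd_K b))) (fobj (Dcat (dd_n a) (dd_K a))) (fob (ra_d X)).
  exact: plus_inj.
have le2 := leq_card _ di.
have le1 : dd_n a <= dd_n b.
  have [->//|n0] := posnP (dd_n a).
  have [f [fi _]] := plus_alpha_inl Xp n0.
  by have := leq_card _ fi; rewrite !card_ord.
rewrite /DDdeg ltnNge; apply/negP => le; apply: nid; apply: plus_minus_identity => //.
have ds := card_inj_surj di ltac:(lia).
split=> //; have [n0|n0] := posnP (dd_n a); last first.
  have [f [fi fE]] := plus_alpha_inl Xp n0.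
  have fs := card_inj_surj fi; rewrite !card_ord in fs.
  by move=> j; have [|i fi'] := fs _ j; [lia|exists i; rewrite fE fi'].
(* Both objects have n = 0; it remains to see that alpha avoids the stars. *)
case: a b X Xp di le2 le1 le ds n0 => n K [m L] X Xp di le2 le1 le ds /= n0; subst n.
have m0 : m = 0 by move: le le2 => /=; lia.
subst m => j; exists ord0; rewrite [j]ord1.
change (fob (alpha X) ord0 = inl ord0).
case E: (fob (alpha X) ord0) => [i|k]; first by rewrite (ord1 i).
(* A star would be the moment of beta of the last vertex, but beta is now a
   monotone surjection of chains and so hits the last vertex, of moment 0. *)
have lL : L.-1 < L by have := ltn_ord k; rewrite /=; lia.
have [x Xx] := ds (Ordinal lL : fobj (Dcat 0 L)).
have [z zK] := Dcat_last (x : fobj (Dcat 0 K)).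
have xz : (x : 'I_K) <= z by have := ltn_ord (x : 'I_K); lia.
have xz' := @functor_ord_mono K L (beta X) _ _ xz.
have := @mu_beta_last _ _ X z zK; rewrite E.
change (fob (ra_d X) x) with (fob (beta X) x) in Xx; rewrite Xx in xz' *.
rewrite (@mu_base_last 0 L (fob (beta X) z)) //.
have := ltn_ord (fob (beta X) z : 'I_L); move: xz' => /=; lia.
Qed.

(** Stated as an equality in the sum over the middle object, so that the equality of
    objects carried by an identity need not be transported by hand. *)
Lemma is_identity_factor (a b c c' : DeltaDelta) (e : hom a c) (m : hom c' b) (w : hom c c') :
  is_identity w ->
  existT (fun c => (hom a c * hom c b)%type) c (e, hcomp m w) =
  existT (fun c => (hom a c * hom c b)%type) c' (hcomp w e, m).
Proof.
by move=> wid; case: c c' w / wid e m => c e m; rewrite hcomp_idl hcomp_idr.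
Qed.

Lemma DD_reedy : is_reedy DDplus DDminus DDdeg.
Proof.
split.
- split; last by move=> *; apply: plus_comp.
  by move=> a; split; [move=> x y [] | exact: base_inj].
- split; last by move=> *; apply: minus_comp.
  by move=> a; split=> x; exists x.
- by move=> a b f; apply: plus_deg.
- by move=> a b f; apply: minus_deg.
move=> a b X; have [c [e [m [em mp XE]]]] := factor_exists X.
exists (existT _ c (e, m)); split=> // -[c' [e' m']] [em' mp' XE'].
move: (e' : hom a c') (m' : hom c' b) em' mp' XE' => {}e' {}m' em' mp' XE'.
have {}XE' : X = hcomp m' e' by [].
have [f [g [eS fm gm fs gs]]] := minus_simplicial em.
have [f' [g' [eS' fm' gm' fs' gs']]] := minus_simplicial em'.
have [s [sf [sg [sS _ _ es _]]]] := minus_section eS fm gm fs gs.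
pose w := hcomp e' s.
have mw : m = hcomp m' w.
  by rewrite /w hcomp_assoc -XE' XE -hcomp_assoc es hcomp_idr.
have we : hcomp w e = e'.
  apply: (plus_monic mp' (simplicial_comp eS (simplicial_comp sS eS')) eS').
  by rewrite hcomp_assoc -mw -XE XE'.
rewrite mw -[in RHS]we; apply: is_identity_factor; apply: plus_minus_identity.
  by apply: (@plus_cancel _ _ _ m'); rewrite -mw.
by apply: (minus_cancel em); rewrite we.
Qed.

(** * Elegance *)

(** The square consists of split epimorphisms and the pushout is witnessed by equations
    between morphisms alone, so that it survives the passage to presheaves.  If
    x1, x2 have the same restriction w to r, then e1 and e2 fix w, hence so does
    d t, and d^* w restricts to x1 and x2; the section v of t gives uniqueness. *)
Lemma split_pushout (R : category) (r a1 a2 b : R) (s1 : hom r a1) (s2 : hom r a2)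
    (d1 : hom a1 r) (d2 : hom a2 r) (t : hom r b) (d : hom b r) (v : hom b r)
    (n : nat) :
  let e1 := hcomp d1 s1 in let e2 := hcomp d2 s2 in
  hcomp s1 d1 = hid a1 -> hcomp s2 d2 = hid a2 -> hcomp t v = hid b ->
  hcomp t e1 = t -> hcomp t e2 = t ->
  hcomp d t = iter n (hcomp (hcomp e1 e2)) (hid r) ->
  is_psh_pushout (yoneda_map s1) (yoneda_map s2)
    (yoneda_map (hcomp t d1)) (yoneda_map (hcomp t d2)).
Proof.
move=> e1 e2 sd1 sd2 tv te1 te2 dt.
have t1s1 : hcomp (hcomp t d1) s1 = t by rewrite -hcomp_assoc.
have t2s2 : hcomp (hcomp t d2) s2 = t by rewrite -hcomp_assoc.
have nt_eq (P Q : presheaf R) (u u' : nat_trans P Q) : (forall a x, u a x = u' a x) -> u = u'.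
  case: u u' => [u up] [u' u'p] /= E.
  have {}E : u = u'.
    apply: functional_extensionality_dep => x; exact: functional_extensionality.
  by subst; f_equal; exact: proof_irrelevance.
split.
  by apply: nt_eq => a x /=; rewrite !hcomp_assoc t1s1 t2s2.
move=> Q u1 u2 E.
have uE a (u : nat_trans (yoneda a) Q) c (x : hom c a) : u c x = pshr x (u a (hid a)).
  by rewrite -nt_natural /= hcomp_idl.
(* By the Yoneda lemma a cocone is a pair of elements with equal restrictions. *)
pose x1 := u1 a1 (hid a1); pose x2 := u2 a2 (hid a2).
have W : pshr s1 x1 = pshr s2 x2.
  rewrite -!uE; have := congr1 (fun u : nat_trans (yoneda r) Q => u r (hid r)) E.
  by rewrite /= !hcomp_idr.
pose w := pshr s1 x1.
have e1w : pshr e1 w = w.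
  by rewrite /w -pshr_comp hcomp_assoc sd1 hcomp_idl.
have e2w : pshr e2 w = w.
  by rewrite /w W -pshr_comp hcomp_assoc sd2 hcomp_idl.
have tdw : pshr t (pshr d w) = w.
  rewrite -pshr_comp dt; elim: (n) => [|m IH]; first exact: pshr_id.
  by rewrite iterS pshr_comp pshr_comp e1w e2w.
pose x := pshr d w.
have t1x : pshr (hcomp t d1) x = x1.
  by rewrite pshr_comp tdw /w -pshr_comp sd1 pshr_id.
have t2x : pshr (hcomp t d2) x = x2.
  by rewrite pshr_comp tdw /w W -pshr_comp sd2 pshr_id.
have un (y y' : Q b) : pshr (hcomp t d1) y = pshr (hcomp t d1) y' -> y = y'.
  move=> /(congr1 (fun z => pshr v (pshr s1 z))).
  by rewrite -!pshr_comp !hcomp_assoc t1s1 tv !pshr_id.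
unshelve eexists (@NatTrans R (yoneda b) Q (fun c (f : yoneda b c) => pshr f x) _).
  by move=> c c' f y /=; rewrite pshr_comp.
split.
  split; apply: nt_eq => c f /=; rewrite pshr_comp ?t1x ?t2x; by rewrite -uE.
move=> u [u1E _]; apply: nt_eq => c f /=; rewrite (uE _ u); congr (pshr f _).
apply: un; rewrite t1x -uE /x1 -u1E /=.
by rewrite hcomp_idr.
Qed.

Lemma iter_simplicial (a : DeltaDelta) (X : hom a a) f g n :
  simplicial X f g -> simplicial (iter n (hcomp X) (hid a)) (iter n f) (iter n g).
Proof.
move=> S; elim: n => [|n IH]; first exact: simplicial_id.
exact: (simplicial_comp IH S).
Qed.

Lemma DD_elegant : is_elegant DDminus.
Proof.
move=> r a1 a2 s1 s2 s1m s2m.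
have [f1 [g1 [S1 f1m g1m f1s g1s]]] := minus_simplicial s1m.
have [f2 [g2 [S2 f2m g2m f2s g2s]]] := minus_simplicial s2m.
have [d1 [f1' [g1' [D1 f1'm g1'm sd1 [le1 ge1]]]]] := minus_section S1 f1m g1m f1s g1s.
have [d2 [f2' [g2' [D2 f2'm g2'm sd2 [le2 ge2]]]]] := minus_section S2 f2m g2m f2s g2s.
pose e1 := hcomp d1 s1; pose e2 := hcomp d2 s2.
(* n bounds the length of the chains in both components. *)
pose n := maxn (dd_n r) (dd_K r).
pose e := iter n (hcomp (hcomp e1 e2)) (hid r).
have E1 : simplicial e1 _ _ := simplicial_comp S1 D1.
have E2 : simplicial e2 _ _ := simplicial_comp S2 D2.
have Ee : simplicial e _ _ := iter_simplicial n (simplicial_comp E2 E1).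
have [||||||||F1 F2] := @interior_iter 'I_(dd_n r).+1 (fun x y => x <= y) val
   (f1' \o f1) (f2' \o f2) n => //.
- by move=> x y z; exact: leq_trans.
- by move=> x y; rewrite leq_eqVlt => /orP[/eqP/val_inj|]; [left|right].
- by move=> x; rewrite leq_max -ltnS ltn_ord.
- by move=> x y /f1m/f1'm.
- by move=> x y /f2m/f2'm.
have [||||||||G1 G2] := @interior_iter 'I_(dd_K r) (fun x y => y <= x) (fun x => dd_K r - x)
   (g1' \o g1) (g2' \o g2) n => //.
- by move=> x y z yx zy; exact: leq_trans zy yx.
- move=> x y; rewrite leq_eqVlt => /orP[/eqP/val_inj|]; [left=> //|right].
  by have := ltn_ord x; lia.
- by move=> x; rewrite leq_max leq_subr orbT.
- by move=> x y /g1m/g1'm.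
- by move=> x y /g2m/g2'm.
have ee1 : hcomp e e1 = e by apply: simplicial_eq (simplicial_comp E1 Ee) Ee _ _.
have ee2 : hcomp e e2 = e by apply: simplicial_eq (simplicial_comp E2 Ee) Ee _ _.
have [b [t [d [tm dp eE]]]] := factor_exists e.
have [ft [gt [T ftm gtm fts gts]]] := minus_simplicial tm.
have [v [_ [_ [_ _ _ tv _]]]] := minus_section T ftm gtm fts gts.
have te1 : hcomp t e1 = t.
  by apply: (plus_monic dp (simplicial_comp E1 T) T); rewrite hcomp_assoc -eE.
have te2 : hcomp t e2 = t.
  by apply: (plus_monic dp (simplicial_comp E2 T) T); rewrite hcomp_assoc -eE.
exists b, (hcomp t d1), (hcomp t d2); split.
- by apply: (minus_cancel s1m); rewrite -hcomp_assoc te1.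
- by apply: (minus_cancel s2m); rewrite -hcomp_assoc te2.
- by rewrite -!hcomp_assoc te1 te2.
exact: (split_pushout sd1 sd2 tv te1 te2 (esym eE)).
Qed.

Theorem theorem2p18 :
  is_reedy DDplus DDminus DDdeg /\ is_elegant DDminus.
Proof. by split; [exact: DD_reedy | exact: DD_elegant]. Qed.
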